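(* For $1\le k\le n$, we have $$g[k,n]=S[n+1,n-k+1]\cdot q^{-\binom{n-k+1}{2}}.$$
   Context: Let $V$ be an $n$-dimensional complex vector space with fixed ordered basis $e_1,\dots,e_n$. For $W=[e_i,e_j]:=\langle e_i,\dots,e_j\rangle$ ($i\le j$) put $l(W)=i$, $r(W)=j$. A rank set for $G(k,n)$ is a set $M=\{W_1,\dots,W_k\}$ of $k$ such subspaces with $l(W_i)\ne l(W_j)$ and $r(W_i)\neq r(W_j)$ for $i\ne j$. The rank variety $X(M)\subset G(k,n)$ is the Zariski closure, in the Grassmannian of $k$-dimensional subspaces of $V$, of the set of $k$-planes having a basis $b_1,\dots,b_k$ with $b_i\in W_i$. For $1\le k\le n$ define $g[k,n]=\sum_M q^{\dim(X(M))}$, the sum over all rank sets $M$ for $G(k,n)$ (with respect to the fixed ordered basis). Let $[k]=1+q+\dots+q^{k-1}$. The $q$-Stirling numbers $S[n,k]$ are defined by the recurrence $$S[n,k]=q^{k-1}S[n-1,k-1]+[k]\,S[n-1,k]$$ with initial conditions $S[0,0]=1$, $S[n,0]=0$ for $n>0$, and $S[n,k]=0$ for $k>n$. *)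

(* Defs.v *)
From HB Require Import structures.
From mathcomp Require Import all_boot all_order all_algebra.
From mathcomp Require Import boolp classical_sets reals.
From mathcomp Require Import complex mpoly.

Set Implicit Arguments.
Unset Strict Implicit.
Unset Printing Implicit Defensive.

Import GRing.Theory.
Local Open Scope ring_scope.

Section RankVarieties.
Variables (K : fieldType) (V : vectType K) (n : nat) (e : n.-tuple V).

(* A pair w stands for the subspace [e_(w.1), e_(w.2)], so that l = w.1 and
   r = w.2. By [basis_interval_inj] this encoding is faithful when w.1 <= w.2. *)
Definition basis_interval (w : 'I_n * 'I_n) : {vspace V} :=
  <<[seq tnth e m | m in [pred m : 'I_n | w.1 <= m <= w.2]%N]>>%VS.

Lemma mem_basis_interval (w : 'I_n * 'I_n) (m : 'I_n) : free e ->
  (tnth e m \in basis_interval w) = (w.1 <= m <= w.2)%N.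
Proof.
move=> fe; apply/idP/idP => [em|wm]; last first.
  by apply/memv_span/mapP; exists m; rewrite // mem_enum.
apply: contraT => wm.
have cm p : coord e m (tnth e p) = (p == m)%:R.
  by rewrite (tnth_nth 0) coord_free.
suff /eqP : coord e m (tnth e m) = 0 by rewrite cm eqxx oner_eq0.
rewrite (coord_span (X := in_tuple _) em) linear_sum big1 // => i _ /=.
have /mapP[p + ->] := mem_nth 0 (ltn_ord i).
rewrite mem_enum inE linearZ /= cm => wp.
by case: eqP wp wm => [->->|_ _ _] //; rewrite mulr0.
Qed.

Lemma basis_interval_inj : free e ->
  {in [pred w : 'I_n * 'I_n | (w.1 <= w.2)%N] &, injective basis_interval}.
Proof.
move=> fe [i j] [i' j']; rewrite !inE /= => ij ij' eqI.
have H m := congr1 (fun W : {vspace V} => tnth e m \in W) eqI.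
have := (H i, H j, (H i', H j')); rewrite !(mem_basis_interval _ _ fe) /=.
rewrite !leqnn ij ij' /= => -[[/esym/andP[A B] /esym/andP[C D]]].
move=> [/andP[A' B'] /andP[C' D']].
by congr pair; apply/val_inj/anti_leq; rewrite ?A ?A' ?D ?D'.
Qed.

Definition rank_set (k : nat) (M : {set 'I_n * 'I_n}) : bool :=
  [&& #|M| == k,
      [forall w in M, (w.1 <= w.2)%N]
    & [forall w in M, forall w' in M,
        (w != w') ==> (w.1 != w'.1) && (w.2 != w'.2)]].

Section Grassmannian.
Variable k : nat.

Definition grassmannian : set {vspace V} := [set U | \dim U = k]%classic.

Definition ksubset : finType := {I : {set 'I_n} | #|I| == k}.

Definition kcol (I : ksubset) (j : 'I_k) : 'I_n :=
  enum_val (cast_ord (esym (eqP (valP I))) j).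

(* Number of Pluecker coordinates; they are indexed by ksubset via enum_val. *)
Definition nplucker : nat := #|{: ksubset}|.

(* The maximal minors, with columns in increasing order, of the matrix of
   coordinates in e of the basis vbasis U. Another basis of U rescales the
   whole vector by a nonzero constant, so that the vanishing of a homogeneous
   polynomial does not depend on the choice of vbasis. *)
Definition plucker (U : {vspace V}) (m : 'I_nplucker) : K :=
  \det (\matrix_(i < k, j < k) coord e (kcol (enum_val m) j) (vbasis U)`_i).

(* Zariski topology of the Grassmannian in its Pluecker embedding. *)
Definition zclosed (Z : set {vspace V}) : Prop :=
  exists S : set {mpoly K[nplucker]},
    (forall p, S p -> exists d, p \is d.-homog) /\
    Z = [set U | grassmannian U /\ forall p, S p -> p.@[plucker U] = 0]%classic.

Definition zclosure (A : set {vspace V}) : set {vspace V} :=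
  [set U | forall Z, zclosed Z -> (A `<=` Z)%classic -> Z U]%classic.

Definition zirreducible (Z : set {vspace V}) : Prop :=
  (Z !=set0)%classic /\
  forall A B, zclosed A -> zclosed B ->
    (Z `<=` A `|` B)%classic -> (Z `<=` A)%classic \/ (Z `<=` B)%classic.

Definition has_chain (X : set {vspace V}) (d : nat) : Prop :=
  exists Z : nat -> set {vspace V},
    (forall i, (i <= d)%N ->
       [/\ zclosed (Z i), zirreducible (Z i) & (Z i `<=` X)%classic]) /\
    (forall i, (i < d)%N -> (Z i `<` Z i.+1)%classic).

(* Krull dimension of a closed subset X (the closed subsets of such an X are
   the closed subsets of the Grassmannian contained in X); the default value 0
   is only taken if the lengths of the chains have no maximum. *)
Definition zdim (X : set {vspace V}) : nat :=
  xget 0%N [set d | has_chain X d /\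
                    forall d', has_chain X d' -> (d' <= d)%N]%classic.

(* The k-planes with a basis (b_w), w in M, such that b_w lies in W_w. *)
Definition rank_locus (M : {set 'I_n * 'I_n}) : set {vspace V} :=
  [set U | grassmannian U /\
     exists b : 'I_n * 'I_n -> V,
       basis_of U [seq b w | w <- enum M] /\
       forall w, w \in M -> b w \in basis_interval w]%classic.

Definition rank_variety (M : {set 'I_n * 'I_n}) : set {vspace V} :=
  zclosure (rank_locus M).

Definition rank_poly : {poly int} :=
  \sum_(M : {set 'I_n * 'I_n} | rank_set k M) 'X^(zdim (rank_variety M)).

End Grassmannian.
End RankVarieties.

Definition qint (k : nat) : {poly int} := \sum_(i < k) 'X^i.

Fixpoint qstirling (n k : nat) : {poly int} :=
  match n, k with
  | 0, 0 => 1
  | 0, _.+1 => 0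
  | _.+1, 0 => 0
  | n'.+1, k'.+1 => 'X^k' * qstirling n' k' + qint k * qstirling n' k
  end.

(* Main.v *)
Require Import Defs.
From HB Require Import structures.
From mathcomp Require Import all_boot all_order all_algebra.
From mathcomp Require Import fingroup perm boolp classical_sets reals.
From mathcomp Require Import complex mpoly zify.

(** Fix a rank set M with left ends l(w) and right ends r(w), w in M. A k-plane
    with a sufficiently general basis b_w in W_w can be put in a normal form:
    scale b_w so that its coordinate at l(w) is 1, and use the basis vectors
    b_w' with w' strictly inside w to clear the coordinates of b_w at the l(w').
    What remains arbitrary are the coordinates of b_w at the positions c with
    l(w) < c <= r(w) that are not left ends of such w': the free positions of M.
    Let d be their number. The main point is dim X(M) = d
    ([zdim_rank_variety]).

    Upper bound. X(M) is the closure of the image of a polynomial map on affine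
    d-space ([rank_locus_sub_spans]: a plane without normal form is a limit of
    planes with one). Suppose Z_0 < ... < Z_m is a chain of irreducible closed
    subsets with m > d, and take forms f_0, ..., f_m in the Pluecker coordinates,
    of equal degree, with f_j zero on Z_(j-1) but not on Z_j
    ([chain_separating_forms]). Pulled back to affine d-space they are more than
    d + 1 polynomials in d variables, and counting monomials gives a nontrivial
    homogeneous relation between them ([homog_dependence]). It persists on
    X(M), yet forms that separate a chain satisfy no such relation
    ([chain_homog_independent]): on Z_m divide by the largest common power of
    f_m, restrict to Z_(m-1), where f_m vanishes, and go on down to Z_0.

    Lower bound. Switch on the free positions one at a time, in order of
    decreasing l(w). The matrices supported on the positions that are switched
    on form an affine space, so that the closure of their row spaces is
    irreducible ([zirreducible_spans]). Each new position enlarges this closure,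
    because some single Pluecker coordinate detects it ([separating_minor]).

    Combinatorics. Sort the rank sets contained in [1, n+1] according to
    whether some interval ends at n+1. If [l, n+1] is removed from M, then the
    free positions of the other intervals do not change, and those of [l, n+1]
    are the c > l that are not left ends of the remaining set M'. The possible l
    are the n - k + 1 numbers that are not left ends of M', when M' has k
    elements, so they contribute 1 + q + ... + q^(n-k). This gives
    g[k+1, n+1] = g[k+1, n] + [n-k+1] g[k, n] ([truncated_rank_polyS]), which is
    the recurrence of the q-Stirling numbers after multiplication by
    q^binom(n-k+1, 2). *)

Set Implicit Arguments.
Unset Strict Implicit.
Unset Printing Implicit Defensive.

Import GRing.Theory.
Local Open Scope ring_scope.

(** * Maximal minors *)

(** The ring is arbitrary, so that minors of matrices of polynomials are covered. *)
Definition minors (R : comNzRingType) (n k : nat) (A : 'M[R]_(k, n))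
    (m : 'I_(nplucker n k)) : R :=
  \det (colsub (kcol (enum_val m)) A).

Lemma kcol_inj (n k : nat) (I : ksubset n k) : injective (kcol I).
Proof. by move=> i j /enum_val_inj /cast_ord_inj. Qed.

Lemma kcol_mem (n k : nat) (I : ksubset n k) j : kcol I j \in val I.
Proof. exact: enum_valP. Qed.

(** A minor is defined through an increasing enumeration of its columns; here the
    columns may come in any order, at the price of a sign that does not depend
    on the matrix. *)
Lemma minors_colsub (n k : nat) (f : 'I_k -> 'I_n) : injective f ->
  exists (m : 'I_(nplucker n k)) (s : 'S_k),
    forall (R : comNzRingType) (A : 'M[R]_(k, n)),
      minors A m = (-1) ^+ s * \det (colsub f A).
Proof.
move=> fI.
have cI : #|f @: 'I_k| == k by rewrite card_imset ?card_ord.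
pose I : ksubset n k := exist (fun J : {set 'I_n} => #|J| == k) _ cI.
have imI j : exists i, f i == kcol I j.
  by have /imsetP[i _ ->] := kcol_mem I j; exists i.
pose g j := xchoose (imI j).
have gE j : f (g j) = kcol I j by apply/eqP/(xchooseP (imI j)).
have gI : injective g.
  by move=> i j /(congr1 f); rewrite !gE => /kcol_inj.
exists (enum_rank I), (perm gI)^-1%g => R A.
rewrite /minors enum_rankK.
have -> : colsub (kcol I) A = col_perm (perm gI) (colsub f A).
  by apply/matrixP => i j; rewrite !mxE permE gE.
by rewrite col_permE det_mulmx det_perm mulrC.
Qed.

Lemma minors_map (R S : comNzRingType) (h : {rmorphism R -> S}) n k
    (A : 'M[R]_(k, n)) m :
  minors (map_mx h A) m = h (minors A m).
Proof. by rewrite /minors -map_mxsub det_map_mx. Qed.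

Lemma minors_mulmx (R : comNzRingType) n k (G : 'M[R]_k) (A : 'M[R]_(k, n)) m :
  minors (G *m A) m = \det G * minors A m.
Proof. by rewrite /minors -mulmx_colsub det_mulmx. Qed.

Lemma minors_neq0 (K : fieldType) n k (A : 'M[K]_(k, n)) : row_free A ->
  exists m, minors A m != 0.
Proof.
rewrite -row_leq_rank -mxrank_tr => rA.
have fA : row_full A^T by rewrite -col_leq_rank.
have [m [s mE]] := minors_colsub (@fullrankfun_inj _ _ _ _ fA).
exists m; rewrite mE mulf_neq0 ?signr_eq0 //.
rewrite -unitfE -unitmxE -unitmx_tr trmx_mxsub.
exact: fullrowsub_unit.
Qed.

(** * Row spaces and closed subsets of the Grassmannian *)

Section RowSpans.
Variables (K : fieldType) (V : vectType K) (n : nat) (e : n.-tuple V).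
Hypothesis he : basis_of fullv e.

Definition vec_of_row (u : 'rV[K]_n) : V := \sum_(j < n) u 0 j *: e`_j.
Definition row_of_vec (v : V) : 'rV[K]_n := \row_j coord e j v.

Lemma vec_of_rowK : cancel vec_of_row row_of_vec.
Proof.
move=> u; apply/rowP => j.
by rewrite mxE /vec_of_row coord_sum_free // (basis_free he).
Qed.

Lemma row_of_vecK : cancel row_of_vec vec_of_row.
Proof.
move=> v; rewrite [RHS](coord_basis he (memvf v)).
by apply: eq_bigr => j _; rewrite mxE.
Qed.

Lemma vec_of_row_mulmx k (c : 'rV[K]_k) (A : 'M[K]_(k, n)) :
  vec_of_row (c *m A) = \sum_i c 0 i *: vec_of_row (row i A).
Proof.
rewrite /vec_of_row.
under [RHS]eq_bigr => i _ do rewrite scaler_sumr.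
rewrite exchange_big /=; apply: eq_bigr => j _.
by rewrite mxE scaler_suml; apply: eq_bigr => i _; rewrite !mxE scalerA.
Qed.

Definition mxspan k (A : 'M[K]_(k, n)) : {vspace V} :=
  <<[tuple vec_of_row (row i A) | i < k]>>%VS.

Lemma mem_mxspan k (A : 'M[K]_(k, n)) v :
  (v \in mxspan A) = (row_of_vec v <= A)%MS.
Proof.
apply/idP/submxP => [vA | [c vE]].
  rewrite (coord_span vA).
  exists (\row_i coord [tuple vec_of_row (row i A) | i < k] i v).
  rewrite -[RHS]vec_of_rowK vec_of_row_mulmx; congr row_of_vec.
  apply: eq_bigr => i _; rewrite mxE; congr (_ *: _).
  by rewrite -tnth_nth tnth_mktuple.
rewrite -(row_of_vecK v) vE vec_of_row_mulmx memv_suml // => i _.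
apply/memvZ/memv_span; apply/tnthP.
by exists i; rewrite tnth_mktuple.
Qed.

(** Together with [mem_mxspan], this reduces equalities between subspaces of V to
    row space computations. *)
Lemma eq_mxspan k k' (A : 'M[K]_(k, n)) (B : 'M[K]_(k', n)) :
  (A :=: B)%MS -> mxspan A = mxspan B.
Proof. by move=> AB; apply/vspaceP => v; rewrite !mem_mxspan AB. Qed.

Definition coord_mx k (b : 'I_k -> V) : 'M[K]_(k, n) :=
  \matrix_(i, j) coord e j (b i).

Lemma row_coord_mx k (b : 'I_k -> V) i : row i (coord_mx b) = row_of_vec (b i).
Proof. by apply/rowP => j; rewrite !mxE. Qed.

Lemma basis_coord_mx k (U : {vspace V}) (b : k.-tuple V) : basis_of U b ->
  row_free (coord_mx (tnth b)) /\ mxspan (coord_mx (tnth b)) = U.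
Proof.
move=> bU; split.
  rewrite -kermx_eq0; apply/eqP/row_matrixP => i; rewrite row0.
  have := row_sub i (kermx (coord_mx (tnth b))); rewrite sub_kermx => /eqP c0.
  apply/rowP => j; rewrite [RHS]mxE.
  move: (row i _) c0 => c /(congr1 vec_of_row).
  rewrite vec_of_row_mulmx [X in _ = X](_ : _ = 0); last first.
    by rewrite /vec_of_row big1 // => l _; rewrite mxE scale0r.
  have /freeP bf := basis_free bU.
  move=> c0; apply: (bf (c 0)); rewrite -[RHS]c0; apply: eq_bigr => l _.
  by rewrite row_coord_mx row_of_vecK (tnth_nth 0).
rewrite -(span_basis bU) /mxspan; congr (<<_>>%VS); congr val.
by apply: eq_from_tnth => i; rewrite tnth_mktuple row_coord_mx row_of_vecK.
Qed.

Lemma mxspan_grassmannian k (A : 'M[K]_(k, n)) : row_free A ->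
  grassmannian k (mxspan A).
Proof.
move=> Af; rewrite /grassmannian /=.
suff : free [tuple vec_of_row (row i A) | i < k] by move/eqP; rewrite size_tuple.
apply/freeP => c c0 i.
have : \row_i c i *m A = 0.
  rewrite -[LHS]vec_of_rowK vec_of_row_mulmx.
  rewrite (_ : \sum_i _ = 0); last first.
    rewrite -[RHS]c0; apply: eq_bigr => j _.
    by rewrite mxE -tnth_nth tnth_mktuple.
  by apply/rowP => j; rewrite !mxE linear0.
rewrite -[X in _ = X](mul0mx _ A) => /(row_free_inj Af) /rowP/(_ i).
by rewrite !mxE.
Qed.

Lemma grassmannian_mxspan k (U : {vspace V}) : grassmannian k U ->
  exists2 A : 'M[K]_(k, n), row_free A & U = mxspan A.
Proof.
rewrite /grassmannian /= => <-.
have [fA UE] := basis_coord_mx (vbasisP U).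
by exists (coord_mx (tnth (vbasis U))).
Qed.

(** The rows of A and [vbasis] are two bases of the same subspace; the constant is
    the determinant of the change of basis. *)
Lemma plucker_mxspan k (A : 'M[K]_(k, n)) : row_free A ->
  exists2 c, c != 0 & forall m, plucker e (mxspan A) m = c * minors A m.
Proof.
move=> Af; set U := mxspan A.
have dU : \dim U = k := mxspan_grassmannian Af.
have [Cf CU] := basis_coord_mx (vbasisP U).
pose C : 'M[K]_(k, n) := \matrix_(i, j) coord e j (vbasis U)`_i.
have CE : C = castmx (dU, erefl n) (coord_mx (tnth (vbasis U))).
  by apply/matrixP => i j; rewrite castmxE !mxE /= cast_ord_id (tnth_nth 0).
have {}Cf : row_free C.
  have castf k' (E : k' = k) (B : 'M[K]_(k', n)) :
    row_free B -> row_free (castmx (E, erefl n) B) by subst k'; rewrite castmx_id.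
  by rewrite CE castf.
have /submxP[G GE] : (C <= A)%MS.
  apply/row_subP => i.
  have iU : (i < \dim U)%N by rewrite dU.
  have -> : row i C = row_of_vec (vbasis U)`_i by apply/rowP => j; rewrite !mxE.
  by rewrite -mem_mxspan; apply/vbasis_mem/mem_nth; rewrite size_tuple.
exists (\det G).
  rewrite -unitfE -unitmxE -row_free_unit.
  move: Cf; rewrite -!row_leq_rank => /leq_trans; apply.
  by rewrite GE mxrankM_maxl.
by move=> m; rewrite -minors_mulmx -GE /plucker; congr determinant;
  apply/matrixP => i j; rewrite !mxE.
Qed.

Lemma meval_homog_scale N d (p : {mpoly K[N]}) (c : K) (v w : 'I_N -> K) :
  p \is d.-homog -> (forall i, w i = c * v i) -> p.@[w] = c ^+ d * p.@[v].
Proof.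
move=> /dhomogP hp wE; rewrite !mevalE mulr_sumr.
rewrite big_seq [RHS]big_seq; apply: eq_bigr => m mp.
rewrite mulrCA; congr (_ * _).
under eq_bigr => i _ do rewrite wE exprMn.
rewrite big_split /= prodrXr; congr (_ ^+ _ * _).
by rewrite -mdegE; exact: hp.
Qed.

(** From here on, the vanishing of a form at a row space is tested on the minors of
    any matrix that spans it. *)
Lemma homog_plucker_eq0 k (A : 'M[K]_(k, n)) d (p : {mpoly K[nplucker n k]}) :
  row_free A -> p \is d.-homog ->
  (p.@[plucker e (mxspan A)] == 0) = (p.@[minors A] == 0).
Proof.
move=> Af hp; have [c c0 cE] := plucker_mxspan Af.
by rewrite (meval_homog_scale hp cE) mulf_eq0 expf_eq0 (negPf c0) andbF.
Qed.

Lemma plucker_neq0 k (U : {vspace V}) : grassmannian k U ->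
  exists m : 'I_(nplucker n k), plucker e U m != 0.
Proof.
move=> /grassmannian_mxspan[A Af ->].
have [m mA] := minors_neq0 Af; have [c c0 cE] := plucker_mxspan Af.
by exists m; rewrite cE mulf_neq0.
Qed.

Section Zariski.
Variable k : nat.
Local Notation N := (nplucker n k).

Definition hypersurface (p : {mpoly K[N]}) : set {vspace V} :=
  [set U | grassmannian k U /\ p.@[plucker e U] = 0]%classic.

Lemma zclosed_hypersurface d p : p \is d.-homog ->
  zclosed e k (hypersurface p).
Proof.
move=> hp; exists [set p]%classic; split; first by move=> _ ->; exists d.
apply/seteqP; split => U /= [GU pU]; split => //.
  by move=> _ ->.
exact: pU.
Qed.

Lemma zclosed_sub Z : zclosed e k Z -> (Z `<=` grassmannian k)%classic.
Proof. by move=> [S [_ ->]] U []. Qed.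

(** The closure is cut out by all the forms that vanish on A. The hypothesis on A
    excludes the case in which no closed set contains A. *)
Lemma zclosureP (A : set {vspace V}) : (A `<=` grassmannian k)%classic ->
  forall U, zclosure e k A U <-> grassmannian k U /\
    forall d (p : {mpoly K[N]}), p \is d.-homog ->
      (forall U', A U' -> p.@[plucker e U'] = 0) -> p.@[plucker e U] = 0.
Proof.
move=> AG U; split.
  move=> cU; split.
    suff [] : hypersurface 0 U by [].
    apply: cU; first by apply: (zclosed_hypersurface (d := 0)); exact: dhomog0.
    by move=> U' /AG GU'; split => //; rewrite meval0.
  move=> d p hp pA; suff [] : hypersurface p U by [].
  by apply: cU (zclosed_hypersurface hp) _ => U' AU'; split; [exact: AG|exact: pA].
move=> [GU pU] _ [S [hS ->]] AS; split => // p Sp.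
have [d hp] := hS p Sp.
by apply: (pU d) => // U' /AS[_]; apply.
Qed.

Lemma zclosed_zclosure (A : set {vspace V}) : (A `<=` grassmannian k)%classic ->
  zclosed e k (zclosure e k A).
Proof.
move=> AG; exists [set p | (exists d, p \is d.-homog) /\
  forall U', A U' -> p.@[plucker e U'] = 0]%classic; split; first by move=> p [].
apply/seteqP; split => U; rewrite zclosureP //= => -[GU pU]; split => //.
  by move=> p [[d hp]]; exact: pU hp.
by move=> d p hp pA; apply: pU; split => //; exists d.
Qed.

Lemma zclosure_min (A Z : set {vspace V}) : zclosed e k Z -> (A `<=` Z)%classic ->
  (zclosure e k A `<=` Z)%classic.
Proof. by move=> cZ AZ U; apply. Qed.

Lemma sub_zclosure (A : set {vspace V}) : (A `<=` zclosure e k A)%classic.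
Proof. by move=> U AU Z _; apply. Qed.

Lemma zirreducible_mul Z d d' (p q : {mpoly K[N]}) :
  zirreducible e k Z -> (Z `<=` grassmannian k)%classic ->
  p \is d.-homog -> q \is d'.-homog ->
  (forall U, Z U -> p.@[plucker e U] * q.@[plucker e U] = 0) ->
  (forall U, Z U -> p.@[plucker e U] = 0) \/
  (forall U, Z U -> q.@[plucker e U] = 0).
Proof.
move=> [_ irrZ] ZG hp hq pq.
case: (irrZ _ _ (zclosed_hypersurface hp) (zclosed_hypersurface hq)).
- move=> U ZU; have /eqP := pq U ZU; rewrite mulf_eq0 => /orP[]/eqP pU.
    by left; split => //; exact: ZG.
  by right; split => //; exact: ZG.
- by move=> H; left => U /H[].
- by move=> H; right => U /H[].
Qed.

End Zariski.
End RowSpans.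

(** * Irreducibility of closures of families of row spaces *)

(** This turns the value of a form at a matrix of polynomials into a polynomial
    whose values are those of the form; h is an evaluation and c the embedding
    of constants. *)
Lemma rmorph_mmap (K S : comNzRingType) (c : {rmorphism K -> S})
    (h : {rmorphism S -> K}) (hc : cancel c h) N (v : 'I_N -> S)
    (p : {mpoly K[N]}) :
  h (mmap c v p) = p.@[h \o v].
Proof.
rewrite /mmap rmorph_sum mevalE; apply: eq_bigr => m _.
rewrite rmorphM hc rmorph_prod; congr (_ * _).
by apply: eq_bigr => i _; rewrite rmorphXn.
Qed.

Section Irreducibility.
(* [infK] says that K is infinite, in the form in which it is used: a nonzero
   polynomial in one variable has a nonzero value. *)
Variables (K : fieldType) (V : vectType K) (n : nat) (e : n.-tuple V).
Hypothesis he : basis_of fullv e.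
Hypothesis infK : forall p : {poly K}, p != 0 -> exists t, p.[t] != 0.
Variable k : nat.
Local Notation N := (nplucker n k).

Lemma minors_line_poly (p : {mpoly K[N]}) (A D : 'M[K]_(k, n)) :
  exists f : {poly K}, forall t, f.[t] = p.@[minors (A + t *: D)].
Proof.
pose L : 'M[{poly K}]_(k, n) := map_mx polyC A + 'X *: map_mx polyC D.
exists (mmap polyC (minors L) p) => t.
have hc : cancel (@polyC K) (horner_eval t) by move=> c; rewrite /horner_eval hornerC.
rewrite -[LHS]/(horner_eval t _) (rmorph_mmap hc); apply: meval_eq => m /=.
rewrite -minors_map; congr (minors _ _); apply/matrixP => i j.
by rewrite !mxE /= /horner_eval hornerD hornerM hornerX !hornerC.
Qed.

Lemma poly_eq0_ae (f g : {poly K}) : g != 0 ->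
  (forall t, g.[t] != 0 -> f.[t] = 0) -> f = 0.
Proof.
move=> g0 fg; apply/eqP; apply: contraT => f0.
have [t] := infK (mulf_neq0 f0 g0).
rewrite hornerM mulf_eq0 negb_or => /andP[ft /fg].
by move/eqP; rewrite (negPf ft).
Qed.

Definition spans (P : 'M[K]_(k, n) -> Prop) : set {vspace V} :=
  [set mxspan e A | A in [set A | P A]]%classic.

Lemma spans_grassmannian P : (forall A, P A -> row_free A) ->
  (spans P `<=` grassmannian k)%classic.
Proof. by move=> Pf U [A /= PA <-]; apply: mxspan_grassmannian => //; exact: Pf. Qed.

(** If the closure is contained in neither of two closed sets, then some form p
    defining the first one is nonzero at some A, and some form q defining the
    second one is nonzero at some B. On the line through A and B both are
    nonzero polynomials in one parameter, hence so is their product, and a point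
    where it does not vanish lies in neither set. *)
Lemma zirreducible_spans (P : 'M[K]_(k, n) -> Prop) :
  (forall A, P A -> row_free A) ->
  (exists A, P A) ->
  (forall A B t, P A -> P B -> P (A + t *: (B - A))) ->
  zirreducible e k (zclosure e k (spans P)).
Proof.
move=> Pf [A0 PA0] Pline; split.
  by exists (mxspan e A0); apply: sub_zclosure; exists A0.
move=> _ _ [S [hS ->]] [T [hT ->]] cST.
set ZS := [set U | _]%classic; set ZT := [set U | _]%classic.
have [AS|/existsNP[_ /not_implyP[[A PA <-]] nA]] := pselect (spans P `<=` ZS)%classic.
  by left; apply: zclosure_min => //; exists S.
have [BT|/existsNP[_ /not_implyP[[B PB <-]] nB]] := pselect (spans P `<=` ZT)%classic.
  by right; apply: zclosure_min => //; exists T.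
exfalso.
have {nA} [p [Sp [d hp] pA]] : exists p, [/\ S p, exists d, p \is d.-homog &
    p.@[plucker e (mxspan e A)] != 0].
  apply: contrapT => nE; apply: nA; split.
    by apply: mxspan_grassmannian => //; exact: Pf.
  move=> p Sp; apply/eqP; apply: contrapT => /negP pA.
  by apply: nE; exists p; split => //; exact: hS.
have {nB} [q [Tq [d' hq] qB]] : exists q, [/\ T q, exists d, q \is d.-homog &
    q.@[plucker e (mxspan e B)] != 0].
  apply: contrapT => nE; apply: nB; split.
    by apply: mxspan_grassmannian => //; exact: Pf.
  move=> q Tq; apply/eqP; apply: contrapT => /negP qB.
  by apply: nE; exists q; split => //; exact: hT.
have [f fE] := minors_line_poly p A (B - A).
have [g gE] := minors_line_poly q A (B - A).
have f0 : f != 0.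
  apply: contraNneq pA => f0; rewrite (homog_plucker_eq0 he (Pf _ PA) hp).
  by rewrite -[A in minors A]addr0 -(scale0r (B - A)) -fE f0 horner0.
have g0 : g != 0.
  apply: contraNneq qB => g0; rewrite (homog_plucker_eq0 he (Pf _ PB) hq).
  by rewrite -[B in minors B](subrKC A) -[B - A]scale1r -gE g0 horner0.
have [t] := infK (mulf_neq0 f0 g0).
rewrite hornerM mulf_eq0 negb_or fE gE => /andP[ft gt].
have PC := Pline A B t PA PB.
case: (cST (mxspan e (A + t *: (B - A)))).
- by apply: sub_zclosure; exists (A + t *: (B - A)).
- move=> [_ /(_ p Sp) /eqP].
  by rewrite (homog_plucker_eq0 he (Pf _ PC) hp) (negPf ft).
- move=> [_ /(_ q Tq) /eqP].
  by rewrite (homog_plucker_eq0 he (Pf _ PC) hq) (negPf gt).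
Qed.

(** A closed set containing almost all the row spaces on a line of matrices
    contains them all: a form that vanishes on it restricts to a polynomial in
    the parameter with all but finitely many values equal to 0. *)
Lemma zclosure_perturb (P : 'M[K]_(k, n) -> Prop) (A D : 'M[K]_(k, n)) (g : {poly K}) :
  (forall A, P A -> row_free A) -> row_free A -> g != 0 ->
  (forall t, g.[t] != 0 -> row_free (A + t *: D) ->
     zclosure e k (spans P) (mxspan e (A + t *: D))) ->
  zclosure e k (spans P) (mxspan e A).
Proof.
move=> Pf Af g0 gP; apply/zclosureP => //; first exact: spans_grassmannian.
split; first exact: mxspan_grassmannian.
move=> d p hp pP; apply/eqP; rewrite (homog_plucker_eq0 he Af hp).
have [f fE] := minors_line_poly p A D.
have [m mA] := minors_neq0 Af.
(* h is a minor along the line; where it is nonzero, the matrix has rank k. *)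
have [h hE] := minors_line_poly 'X_m A D.
have h0 : h != 0.
  apply: contraNneq mA => h0; rewrite -(mevalXU (minors A)).
  by rewrite -[A in minors A]addr0 -(scale0r D) -hE h0 horner0.
suff f0 : f = 0 by rewrite -[A in minors A]addr0 -(scale0r D) -fE f0 horner0.
apply: (poly_eq0_ae (mulf_neq0 g0 h0)) => t.
rewrite hornerM mulf_eq0 negb_or hE mevalXU => /andP[gt mt].
have ft : row_free (A + t *: D).
  move: mt; rewrite /minors -unitfE -unitmxE -row_free_unit.
  rewrite -!row_leq_rank => /leq_trans; apply.
  by rewrite -[X in colsub _ X]mulmx1 -mulmx_colsub mxrankM_maxl.
have /zclosureP[|_ /(_ d p hp pP) /eqP] := gP t gt ft; first exact: spans_grassmannian.
by rewrite fE (homog_plucker_eq0 he ft hp) => /eqP.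
Qed.

End Irreducibility.

(** * Homogeneous relations between polynomials *)

Section Dependence.
Variables (K : fieldType) (d : nat).
Implicit Types p q : {mpoly K[d]}.

Lemma msize_mul_bound p q a b : (msize p <= a.+1)%N -> (msize q <= b.+1)%N ->
  (msize (p * q) <= (a + b).+1)%N.
Proof.
move=> pa qb; have [->|p0] := eqVneq p 0; first by rewrite mul0r msize0.
have [->|q0] := eqVneq q 0; first by rewrite mulr0 msize0.
rewrite msizeM //; apply: (@leq_trans (a.+1 + b.+1).-1); last by rewrite addnS.
by rewrite -!subn1 leq_sub2r // leq_add.
Qed.

Lemma msize_exp_bound p C a : (msize p <= C.+1)%N -> (msize (p ^+ a) <= (C * a).+1)%N.
Proof.
move=> pC; elim: a => [|a IH]; first by rewrite expr0 msize1.
by rewrite exprS mulnS; exact: msize_mul_bound.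
Qed.

Lemma msize_prod_bound (I : Type) (r : seq I) (F : I -> {mpoly K[d]}) (b : I -> nat) :
  (forall i, msize (F i) <= (b i).+1)%N ->
  (msize (\prod_(i <- r) F i) <= (\sum_(i <- r) b i).+1)%N.
Proof.
move=> Fb; elim: r => [|i r IH]; first by rewrite !big_nil msize1.
by rewrite !big_cons; exact: msize_mul_bound.
Qed.

(** The left-hand side is the number of monomials with d variables and exponents
    at most D = m Q C, for Q = (m C)^d, the right-hand side that of exponent
    vectors with m entries at most Q. Since D + 1 is at most m C (Q + 1), the
    former is at most Q (Q + 1)^d. *)
Lemma exponent_count m C : (d < m)%N -> (0 < C)%N ->
  ((m * (m * C) ^ d * C).+1 ^ d < ((m * C) ^ d).+1 ^ m)%N.
Proof.
move=> dm C0; set Q := ((m * C) ^ d)%N.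
have mC : (0 < m * C)%N by rewrite muln_gt0 C0 (leq_trans _ dm).
apply: (@leq_ltn_trans ((m * C * Q.+1) ^ d)).
  case: (d) => // r; rewrite leq_exp2r // mulnS mulnAC -add1n.
  by rewrite leq_add2r.
rewrite expnMn -/Q; apply: (@leq_trans (Q.+1 ^ d.+1)); last by rewrite leq_pexp2l.
by rewrite expnS ltn_pmul2r ?expn_gt0.
Qed.

(** The exponents a give the powers of g 1, ..., g m; the power of g 0 makes the
    total degree equal to m Q for every a. *)
Definition homog_monomial (R : comNzRingType) m Q (g : nat -> R)
    (a : {ffun 'I_m -> 'I_Q.+1}) : R :=
  g 0%N ^+ (m * Q - \sum_j a j) * \prod_(j < m) g j.+1 ^+ a j.

Lemma sum_exponents_le m Q (a : {ffun 'I_m -> 'I_Q.+1}) : (\sum_j a j <= m * Q)%N.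
Proof.
apply: (@leq_trans (\sum_(j < m) Q)); last by rewrite sum_nat_const card_ord.
by apply: leq_sum => j _; rewrite -ltnS.
Qed.

(** There are more products [homog_monomial g a] than monomials that can occur in
    them, so that they are linearly dependent. *)
Lemma homog_dependence m (g : nat -> {mpoly K[d]}) : (d < m)%N ->
  exists Q (c : {ffun 'I_m -> 'I_Q.+1} -> K), (exists a, c a != 0) /\
    \sum_a c a *: homog_monomial g a = 0.
Proof.
move=> dm; pose C := (\max_(j < m.+1) msize (g j)).+1.
have gC j : (j <= m)%N -> (msize (g j) <= C.+1)%N.
  move=> jm; apply: leqW; apply: leqW.
  exact: (leq_bigmax (Ordinal (jm : (j < m.+1)%N))).
pose Q := ((m * C) ^ d)%N; exists Q.
(* The successor in the definition of C makes C positive. *)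
have card := @exponent_count m C dm isT; rewrite -/Q in card.
pose D := (m * Q * C)%N.
pose I := {ffun 'I_m -> 'I_Q.+1}; pose J := {ffun 'I_d -> 'I_D.+1}.
have GD (a : I) : (msize (homog_monomial g a) <= D.+1)%N.
  apply: (leq_trans (msize_mul_bound (msize_exp_bound _ (gC 0%N _))
    (msize_prod_bound _ (fun j => msize_exp_bound _ (gC _ (ltn_ord j)))))) => //.
  rewrite ltnS -big_distrr /= -mulnDr mulnC subnK //; exact: sum_exponents_le.
pose mon (b : J) : 'X_{1..d} := [multinom (b i : nat) | i < d].
pose L : 'M[K]_(#|{: I}|, #|{: J}|) :=
  \matrix_(i, j) (homog_monomial g (enum_val i))@_(mon (enum_val j)).
have : kermx L != 0.
  rewrite kermx_eq0 -row_leq_rank -ltnNge.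
  by apply: (leq_ltn_trans (rank_leq_col L)); rewrite !card_ffun !card_ord.
case/rowV0Pn => x /sub_kermxP xL /rV0Pn[i xi].
exists (fun a => x 0 (enum_rank a)); split.
  by exists (enum_val i); rewrite enum_valK.
apply/mpolyP => mm; rewrite mcoeff0 linear_sum /=.
under eq_bigr => a _ do rewrite mcoeffZ.
have [mD|mD] := leqP (mdeg mm) D; last first.
  rewrite big1 // => a _; rewrite (memN_msupp_eq0 (msize_mdeg_ge _)) ?mulr0 //.
  exact: leq_trans (GD a) mD.
pose b : J := [ffun i => inord (mm i)].
have -> : mm = mon b.
  apply/mnmP => l; rewrite mnmE ffunE inordK // ltnS.
  by apply: leq_trans mD; rewrite mdegE (bigD1 l) //= leq_addr.
move/rowP/(_ (enum_rank b)): xL; rewrite mxE [RHS]mxE => xL; rewrite -[RHS]xL.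
rewrite [RHS](reindex_onto enum_rank enum_val) => [|? _]; last exact: enum_valK.
by apply: eq_big => [a|a _]; rewrite ?enum_rankK ?eqxx // !mxE !enum_rankK.
Qed.

End Dependence.

(** * Forms separating a chain of irreducible closed sets *)

Lemma dhomog_bigprod (R : comNzRingType) N (I : Type) (r : seq I) (P : pred I)
    (F : I -> {mpoly R[N]}) (d : I -> nat) :
  (forall i, P i -> F i \is (d i).-homog) ->
  \prod_(i <- r | P i) F i \is (\sum_(i <- r | P i) d i)%N.-homog.
Proof.
move=> hF; apply: (big_rec2 (fun (x : nat) (y : {mpoly R[N]}) => y \is x.-homog)).
  exact: dhomog1.
by move=> i x y Pi; apply: dhomogM; exact: hF.
Qed.

Section ChainIndependence.
Variables (K : fieldType) (V : vectType K) (n : nat) (e : n.-tuple V).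
Variable k : nat.
Local Notation N := (nplucker n k).

Section Peeling.
Variables (m Q E : nat) (Z : nat -> set {vspace V}) (f : nat -> {mpoly K[N]}).
Hypothesis irrZ : forall j, (j <= m)%N -> zirreducible e k (Z j).
Hypothesis grZ : forall j, (j <= m)%N -> (Z j `<=` grassmannian k)%classic.
Hypothesis incZ : forall j, (j < m)%N -> (Z j `<=` Z j.+1)%classic.
Hypothesis fH : forall j, (j <= m)%N -> f j \is E.-homog.
Hypothesis fN : forall j, (j <= m)%N ->
  exists2 U, Z j U & (f j).@[plucker e U] != 0.
Hypothesis f0 : forall j, (j < m)%N ->
  forall U, Z j U -> (f j.+1).@[plucker e U] = 0.

Local Notation I := {ffun 'I_m -> 'I_Q.+1}.

Let partial_monomial s (a : I) : {mpoly K[N]} :=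
  f 0%N ^+ (m * Q - \sum_j a j) * \prod_(j < m | (j < s)%N) f j.+1 ^+ a j.

(** Starting from the exponents a with c a != 0 and going down from Z_m to Z_0, keep
    at each step those with the least exponent of the next form. The relation
    between the terms kept is divisible by a power of that form, which is
    nonzero somewhere on the irreducible set Z_(s+1) and can be cancelled; on
    Z_s, where the form vanishes, only the terms with least exponent survive. At
    Z_0 a single term remains, and f_0 does not vanish on Z_0. *)
Lemma chain_homog_independent (c : I -> K) :
  (forall U, Z m U -> (\sum_a c a *: homog_monomial f a).@[plucker e U] = 0) ->
  forall a, c a = 0.
Proof.
move=> rel a0; apply/eqP; apply: contraT => ca0.
have peel t : (t <= m)%N -> exists A : {set I},
    [/\ A != finset.set0, forall a, a \in A -> c a != 0,
      forall a b (j : 'I_m), a \in A -> b \in A -> (m - t <= j)%N -> a j = b j &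
      forall U, Z (m - t)%N U ->
        (\sum_(a in A) c a *: partial_monomial (m - t) a).@[plucker e U] = 0].
  elim: t => [_|t IH tm].
    rewrite subn0; exists (finset (fun a => c a != 0)); split.
    - by apply/set0Pn; exists a0; rewrite inE.
    - by move=> a; rewrite inE.
    - by move=> a b j _ _; rewrite leqNgt ltn_ord.
    move=> U ZU; rewrite -[RHS](rel U ZU); congr (_.@[_]).
    rewrite [RHS](bigID (fun a => c a != 0)) /= [X in _ = _ + X]big1 ?addr0.
      apply: eq_big => [a|a _]; first by rewrite inE.
      by congr (_ *: (_ * _)); apply: eq_bigl => j; rewrite ltn_ord.
    by move=> a /negbNE/eqP ->; rewrite scale0r.
  have [A [A0 Ac Aeq Arel]] := IH (ltnW tm).
  have sE : (m - t = (m - t.+1).+1)%N by rewrite -subSn.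
  move: Aeq Arel; rewrite sE; set s := (m - t.+1)%N => Aeq Arel.
  have sm : (s < m)%N by rewrite /s ltn_subrL /=; case: (m) tm.
  pose os := Ordinal sm.
  have [b0 b0A] := set0Pn _ A0.
  pose b := [arg min_(a < b0 in A) (a os : nat)].
  have [bA bmin] : b \in A /\ forall a, a \in A -> (b os <= a os)%N.
    by rewrite /b; case: arg_minnP.
  exists (finset (fun a => (a \in A) && (a os == b os))); split.
  - by apply/set0Pn; exists b; rewrite inE bA /=.
  - by move=> a; rewrite inE => /andP[/Ac].
  - move=> a a' j; rewrite !inE => /andP[aA /eqP ab] /andP[aA' /eqP ab'].
    rewrite leq_eqVlt => /orP[/eqP sj|]; last exact: Aeq.
    by have -> : j = os; [apply/val_inj|rewrite ab ab'].
  (* H is the relation on Z_(s+1) divided by the power of f_(s+1) common to all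
     its terms. *)
  pose H := \sum_(a in A) c a *: (partial_monomial s a * f s.+1 ^+ (a os - b os)).
  have big_s (a : I) (F : 'I_m -> {mpoly K[N]}) :
    \prod_(j < m | (j < s.+1)%N) F j = F os * \prod_(j < m | (j < s)%N) F j.
    rewrite (bigD1 os) ?ltnSn //=; congr (_ * _); apply: eq_bigl => j.
    by rewrite -val_eqE /= ltnS [RHS]ltn_neqAle andbC.
  have HE : \sum_(a in A) c a *: partial_monomial s.+1 a = f s.+1 ^+ b os * H.
    rewrite mulr_sumr; apply: eq_bigr => a aA.
    rewrite -scalerAr; congr (_ *: _); rewrite /partial_monomial big_s //.
    rewrite [RHS]mulrCA [RHS]mulrA -mulrA -exprD subnKC ?bmin //.
    by rewrite mulrCA [RHS]mulrC.
  have split_sum (a : I) : (\sum_j a j = \sum_(j < m | (j < s)%N) a j + a os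
      + \sum_(j < m | (s < j)%N) a j)%N.
    rewrite (bigID (fun j : 'I_m => (j < s)%N)) /= -addnA; congr (_ + _)%N.
    rewrite (bigD1 os) /= ?ltnn //; congr (_ + _)%N; apply: eq_bigl => j.
    by rewrite -leqNgt -val_eqE /= ltn_neqAle eq_sym andbC.
  have HH : H \is (E * (m * Q - \sum_(j < m | (s < j)%N) b j - b os)).-homog.
    apply: rpred_sum => a aA; apply: rpredZ.
    (* All exponents in A agree beyond s, which makes the degrees equal. *)
    have -> : (E * (m * Q - \sum_(j < m | (s < j)%N) b j - b os) =
        E * (m * Q - \sum_j a j) + \sum_(j < m | (j < s)%N) E * a j
        + E * (a os - b os))%N.
      rewrite -big_distrr /= -!mulnDr; congr (_ * _)%N.
      have := sum_exponents_le a; have := bmin a aA; rewrite split_sum.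
      have -> : (\sum_(j < m | (s < j)%N) a j = \sum_(j < m | (s < j)%N) b j)%N.
        by apply: eq_bigr => j sj; rewrite (Aeq a b).
      move: (\sum_(j < m | (j < s)%N) a j)%N (\sum_(j < m | (s < j)%N) b j)%N => x y.
      by move: (nat_of_ord (a os)) (nat_of_ord (b os)) (m * Q)%N => u v w; clear; lia.
    apply: dhomogM; last by apply/dhomogMn/fH.
    apply: dhomogM; first by apply/dhomogMn/fH.
    by apply: dhomog_bigprod => j _; apply/dhomogMn/fH.
  have sm' : (s.+1 <= m)%N by [].
  have [U0 ZU0 fU0] := fN sm'.
  have [|fs0|Hs0] := zirreducible_mul (irrZ sm') (grZ sm')
    (dhomogMn (b os) (fH sm')) HH.
  - by move=> U ZU; rewrite -mevalM -HE; exact: Arel.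
  - by have /eqP := fs0 U0 ZU0; rewrite rmorphXn /= expf_eq0 (negPf fU0) andbF.
  move=> U ZU; rewrite -[RHS](Hs0 U (incZ sm ZU)).
  rewrite /H [in RHS](bigID (fun a : I => a os == b os)) /= mevalD.
  rewrite [X in _ = _ + X]rmorph_sum /= [X in _ = _ + X]big1 ?addr0.
    congr (_.@[_]); apply: eq_big => [a|a]; first by rewrite inE.
    rewrite inE => /andP[_ /eqP ab].
    by rewrite ab subnn expr0 mulr1.
  move=> a /andP[aA ab]; rewrite mevalZ mevalM rmorphXn /= (f0 sm ZU) expr0n.
  have : (b os < a os)%N by rewrite ltn_neqAle bmin // andbT eq_sym.
  by rewrite -subn_gt0 lt0n => /negPf ->; rewrite !mulr0.
have [A [A0 Ac Aeq Arel]] := peel m (leqnn m).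
have [b bA] := set0Pn _ A0.
have [U ZU fU] := fN (leq0n m).
move: (Arel U); rewrite subnn => /(_ ZU) /eqP.
rewrite (big_pred1 b) => [|a]; last first.
  apply/idP/eqP => [aA|->//]; apply/ffunP => j; apply: Aeq => //.
  by rewrite subnn.
rewrite mevalZ /partial_monomial [\prod_(j < m | _) _]big_pred0 // mulr1 rmorphXn /=.
by rewrite mulf_eq0 (negPf (Ac _ bA)) expf_eq0 (negPf fU) andbF.
Qed.
End Peeling.
End ChainIndependence.

(** * Length of chains in a parametrized closed set *)

Section ChainLength.
Variables (K : fieldType) (V : vectType K) (n : nat) (e : n.-tuple V).
Hypothesis he : basis_of fullv e.
Variable k : nat.
Local Notation N := (nplucker n k).

(** A form that vanishes on Z_j and not on all of Z_(j+1) is found among the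
    equations of Z_j. The degrees are made equal by multiplying with powers of
    Pluecker coordinates that are nonzero at the point where the form is. *)
Lemma chain_separating_forms m (Z : nat -> set {vspace V}) :
  (forall j, (j <= m)%N -> zclosed e k (Z j) /\ (Z j !=set0)%classic) ->
  (forall j, (j < m)%N -> (Z j `<` Z j.+1)%classic) ->
  exists E (f : nat -> {mpoly K[N]}), forall j, (j <= m)%N ->
    [/\ f j \is E.-homog,
        exists2 U, Z j U & (f j).@[plucker e U] != 0 &
        forall i, j = i.+1 -> forall U, Z i U -> (f j).@[plucker e U] = 0].
Proof.
move=> cZ incZ.
have /choice[x xP] : forall j, exists x : {mpoly K[N]} * nat * {vspace V},
    (j <= m)%N -> [/\ x.1.1 \is x.1.2.-homog, Z j x.2,
      x.1.1.@[plucker e x.2] != 0 &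
      forall i, j = i.+1 -> forall U, Z i U -> x.1.1.@[plucker e U] = 0].
  case=> [|j].
    have [_ [U ZU]] := cZ 0%N (leq0n m).
    by exists (1, 0%N, U) => _; split => //=; [exact: dhomog1|rewrite meval1 oner_neq0].
  have [jm|] := boolP (j < m)%N; last by exists (0, 0%N, 0%VS).
  have [[S [hS ZE]] _] := cZ j (ltnW jm).
  have [_ /existsNP[U /not_implyP[ZU nZU]]] := incZ j jm.
  have GU := zclosed_sub (cZ _ jm).1 ZU.
  have : exists p, S p /\ p.@[plucker e U] != 0.
    apply: contrapT => nE; apply: nZU; rewrite ZE; split => // p Sp.
    by apply/eqP; apply: contrapT => /negP pU; apply: nE; exists p.
  move=> [p [Sp pU]]; have [d hp] := hS p Sp.
  exists (p, d, U) => _; split => //= i [<-] U'.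
  by rewrite ZE => -[_]; apply.
have /choice[y yP] : forall j, exists i : option 'I_N, (j <= m)%N ->
    exists2 i', i = Some i' & plucker e (x j).2 i' != 0.
  move=> j; have [jm|] := boolP (j <= m)%N; last by exists None.
  have [_ /(zclosed_sub (cZ j jm).1) /(plucker_neq0 he)[i iU] _ _] := xP j jm.
  by exists (Some i) => _; exists i.
exists (\max_(j < m.+1) (x j).1.2).
pose E := (\max_(j < m.+1) (x j).1.2)%N.
(* The default 0 is only taken for j > m. *)
exists (fun j => (x j).1.1 * (if y j is Some i then 'X_i else 0) ^+ (E - (x j).1.2)).
move=> j jm; have [hp ZU pU p0] := xP j jm; have [i -> iU] := yP j jm.
have jE : ((x j).1.2 <= E)%N.
  exact: (leq_bigmax (F := fun j : 'I_m.+1 => (x j).1.2) (Ordinal (jm : (j < m.+1)%N))).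
split.
- rewrite -[X in X.-homog](subnKC jE) -[X in (_ + X)%N]mul1n.
  by apply: dhomogM => //; apply: dhomogMn; rewrite dhomogX /= mdeg1.
- by exists (x j).2 => //; rewrite mevalM rmorphXn /= mevalXU mulf_neq0 ?expf_neq0.
- by move=> i' ji' U ZU'; rewrite mevalM (p0 i' ji' U ZU') mul0r.
Qed.

(** The image of affine d-space under the polynomial map with matrix Phi. *)
Definition specializations d (Phi : 'M[{mpoly K[d]}]_(k, n)) (A : 'M[K]_(k, n)) : Prop :=
  exists v, A = map_mx (meval v) Phi.

(** The Krull dimension of a set with a dense subset parametrized by polynomials is
    at most the number of parameters. *)
Lemma chain_length_bound d (Phi : 'M[{mpoly K[d]}]_(k, n)) (X : set {vspace V}) m :
  (forall A, specializations Phi A -> row_free A) ->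
  (X `<=` zclosure e k (spans e (specializations Phi)))%classic ->
  has_chain e k X m -> (m <= d)%N.
Proof.
move=> Pf XP [Z [ZP incZ]]; rewrite leqNgt; apply/negP => dm.
have [E [f fP]] : exists E (f : nat -> {mpoly K[N]}), forall j, (j <= m)%N ->
    [/\ f j \is E.-homog,
        exists2 U, Z j U & (f j).@[plucker e U] != 0 &
        forall i, j = i.+1 -> forall U, Z i U -> (f j).@[plucker e U] = 0].
  apply: chain_separating_forms => // j jm.
  by have [cZ [nZ _] _] := ZP j jm.
pose g j := mmap (@mpolyC d K) (minors Phi) (f j).
have gE j v : (g j).@[v] = (f j).@[minors (map_mx (meval v) Phi)].
  have hc : cancel (@mpolyC d K) (meval v) by move=> c; rewrite mevalC.
  rewrite -[LHS]/(meval v _) (rmorph_mmap hc); apply: meval_eq => i /=.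
  by rewrite -minors_map.
have [Q [c [[a0 /negP ca0] relg]]] := homog_dependence g dm; apply: ca0.
pose F := \sum_a c a *: homog_monomial f a.
have FH : F \is (E * (m * Q)).-homog.
  apply: rpred_sum => a _; apply: rpredZ.
  rewrite -[X in (_ * X)%N](subnK (sum_exponents_le a)) mulnDr big_distrr.
  apply: dhomogM; first by apply: dhomogMn; case: (fP 0%N isT).
  by apply: dhomog_bigprod => j _; apply: dhomogMn; case: (fP j.+1 (ltn_ord j)).
apply/eqP; apply: (chain_homog_independent (e := e) (Z := Z) (f := f) (E := E)) => //.
- by move=> j /ZP[_ irrZ _].
- by move=> j /ZP[cZ _ _]; exact: zclosed_sub cZ.
- by move=> j /incZ[subZ _].
- by move=> j /fP[fH _ _].
- by move=> j /fP[_ fN _].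
- by move=> j /fP[_ _]; apply.
move=> U ZU; rewrite -/F.
have [_ _ /(_ _ ZU) /XP] := ZP m (leqnn m).
move/(zclosureP e (spans_grassmannian he Pf))=> [_ /(_ _ _ FH)]; apply.
move=> _ [A /= PA <-]; apply/eqP.
rewrite (homog_plucker_eq0 he (Pf _ PA) FH); case: PA => v ->; apply/eqP.
rewrite -[RHS](meval0 v) -relg !rmorph_sum /=; apply: eq_bigr => a _.
rewrite !mevalZ !mevalM !rmorphXn !rmorph_prod /= gE; congr (_ * (_ * _)).
by apply: eq_bigr => j _; rewrite !rmorphXn /= gE.
Qed.

End ChainLength.

(** * Matrices supported on a set of positions *)

Section Triangular.
(* Up to a reordering of the rows by [key], the columns picked by [col] form a
   triangular matrix. *)
Variables (K : fieldType) (k n : nat) (A : 'M[K]_(k, n)).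
Variables (key : 'I_k -> nat) (col : 'I_k -> 'I_n).
Hypothesis diag : forall i, A i (col i) != 0.
Hypothesis below : forall i j, j != i -> (key i <= key j)%N -> A j (col i) = 0.

Lemma triangular_row_free : row_free A.
Proof.
apply/inj_row_free => x xA; apply/rowP => i0; rewrite mxE; apply/eqP.
apply: contraT => xi0.
pose i := [arg min_(i < i0 | x 0 i != 0) key i].
have [xi imin] : x 0 i != 0 /\ forall j, x 0 j != 0 -> (key i <= key j)%N.
  by rewrite /i; case: arg_minnP.
move/rowP/(_ (col i)): xA; rewrite mxE [RHS]mxE (bigD1 i) //= big1 ?addr0.
  by move/eqP; rewrite mulf_eq0 (negPf xi) (negPf (diag i)).
move=> j ji; have [->|xj] := eqVneq (x 0 j) 0; first by rewrite mul0r.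
by rewrite below ?mulr0 ?imin.
Qed.

Lemma triangular_col_inj : injective col.
Proof.
move=> i j ij; apply/eqP; apply: contraT => nij.
have [ij'|/ltnW ji'] := leqP (key i) (key j).
  by have := diag j; rewrite -ij below ?eqxx // eq_sym.
by have := diag i; rewrite ij below ?eqxx.
Qed.
End Triangular.

Definition nested n (w w' : 'I_n * 'I_n) : bool := (w.1 < w'.1)%N && (w'.2 < w.2)%N.

(** The positions (w, c) at which the normal form of a generic k-plane is
    unconstrained. The other positions in the interval w are its left end, which
    carries 1, and the left ends of the intervals nested in w, which carry 0. *)
Definition free_positions n (M : {set 'I_n * 'I_n}) : {set ('I_n * 'I_n) * 'I_n} :=
  finset (fun p : ('I_n * 'I_n) * 'I_n => [&& p.1 \in M, (p.1.1 < p.2 <= p.1.2)%N &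
    [forall w in M, nested p.1 w ==> (p.2 != w.1)]]).

Section PatternedMatrices.
Variables (K : fieldType) (n k : nat) (W : 'I_k -> 'I_n * 'I_n).
Hypothesis W1_inj : forall i j, (W i).1 = (W j).1 -> i = j.
Hypothesis W2_inj : forall i j, (W i).2 = (W j).2 -> i = j.
Hypothesis W_le : forall i, ((W i).1 <= (W i).2)%N.
Local Notation pos := (('I_n * 'I_n) * 'I_n)%type.
Local Notation M := (finset (fun w : 'I_n * 'I_n => w \in codom W)).
Local Notation F := (free_positions M).
Implicit Types (S : {set pos}).

Definition patterned S (A : 'M[K]_(k, n)) : Prop :=
  (forall i, A i (W i).1 = 1) /\
  (forall i c, c != (W i).1 -> (W i, c) \notin S -> A i c = 0).

Lemma free_positionsP i (c : 'I_n) : reflect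
  [/\ ((W i).1 < c)%N, (c <= (W i).2)%N &
      forall j, nested (W i) (W j) -> c != (W j).1]
  ((W i, c) \in F).
Proof.
rewrite inE /= inE codom_f /=; apply: (iffP andP) => [[/andP[ic ci] /forall_inP nes]|].
  by split => // j ij; apply: (implyP (nes _ _)) => //; rewrite inE codom_f.
move=> [-> -> nes]; split=> //; apply/forall_inP => w; rewrite inE => /codomP[j ->].
by apply/implyP; exact: nes.
Qed.

Lemma patterned_row_free S A : S \subset F -> patterned S A -> row_free A.
Proof.
move=> SF [A1 A0].
apply: (@triangular_row_free _ _ _ A (fun i => (W i).1) (fun i => (W i).1)).
  by move=> i; rewrite A1 oner_neq0.
move=> i j ji ij; apply: A0.
  by apply: contraNneq ji => /W1_inj ->.
by apply/negP => /(fintype.subsetP SF)/free_positionsP[]; rewrite ltnNge ij.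
Qed.

Lemma patterned_line S A B t : patterned S A -> patterned S B ->
  patterned S (A + t *: (B - A)).
Proof.
move=> [A1 A0] [B1 B0]; split => [i|i c ic iS]; rewrite !mxE.
  by rewrite A1 B1 subrr mulr0 addr0.
by rewrite A0 ?B0 // subrr mulr0 addr0.
Qed.

Lemma patterned_exists S : exists A, patterned S A.
Proof.
exists (\matrix_(i, c) (c == (W i).1)%:R); split => [i|i c /negPf ic _].
  by rewrite mxE eqxx.
by rewrite mxE ic.
Qed.

Lemma patterned_sub S S' A : S \subset S' -> patterned S A -> patterned S' A.
Proof.
move=> SS' [A1 A0]; split => // i c ic iS'; apply: A0 => //.
by apply: contra iS'; exact: (fintype.subsetP SS').
Qed.

Definition pattern_mx S : 'M[{mpoly K[#|S|]}]_(k, n) :=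
  \matrix_(i, c) if c == (W i).1 then 1
                 else \sum_(x < #|S| | enum_val x == (W i, c)) 'X_x.

Lemma patterned_specializations S A :
  patterned S A <-> specializations (pattern_mx S) A.
Proof.
split => [[A1 A0]|[v ->]]; last first.
  split => [i|i c /negPf ic iS]; first by rewrite !mxE eqxx meval1.
  rewrite !mxE ic big_pred0 ?meval0 // => x; apply/eqP => xE.
  by move: iS; rewrite -xE enum_valP.
have /choice[idx idxP] : forall p : pos, exists i, forall j, p.1 = W j -> i = Some j.
  move=> p; have [/codomP[j pj]|nC] := boolP (p.1 \in codom W).
    by exists (Some j) => j'; rewrite pj => /(congr1 fst)/W1_inj ->.
  by exists None => j pj; move: nC; rewrite pj codom_f.
exists (fun x => if idx (enum_val x) is Some i then A i (enum_val x).2 else 0).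
apply/matrixP => i c; rewrite !mxE; have [->|ic] := eqVneq.
  by rewrite A1 meval1.
have [iS|iS] := boolP ((W i, c) \in S).
  rewrite (big_pred1 (enum_rank_in iS (W i, c))) => [|x]; last first.
    by rewrite -[RHS](inj_eq enum_val_inj) enum_rankK_in.
  by rewrite mevalXU enum_rankK_in // (idxP (W i, c) i).
rewrite A0 // big_pred0 ?meval0 // => x; apply/eqP => xE.
by move: iS; rewrite -xE enum_valP.
Qed.

(** The columns are those of the system of representatives [sigma]: c for W_i0, the
    right end for the intervals that lie to the right of W_i0 at both ends, and
    the left end for all the others. None of these columns is free or pivot for
    row i0 except c, so that row i0 of the minor is zero as long as c is
    switched off. When it is switched on, the 0-1 matrix with support given by
    the left ends and by [sigma] has a triangular minor. *)
Lemma separating_minor S S' i0 (c : 'I_n) :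
  S \subset F -> S' \subset F -> (W i0, c) \in S' -> (W i0, c) \notin S ->
  (forall j x, ((W i0).1 < (W j).1)%N -> (W j, x) \in F -> (W j, x) \in S') ->
  exists m : 'I_(nplucker n k),
    (forall A, patterned S A -> minors A m = 0) /\
    exists2 A, patterned S' A & minors A m != 0.
Proof.
move=> SF S'F cS' cS upS'.
have /free_positionsP[ic ci nes] := fintype.subsetP S'F _ cS'.
pose shifted j := ((W i0).1 < (W j).1)%N && ((W i0).2 < (W j).2)%N.
pose sigma j := if j == i0 then c else if shifted j then (W j).2 else (W j).1.
have sigmaP j : [\/ j = i0 /\ sigma j = c,
    [/\ j != i0, shifted j & sigma j = (W j).2] |
    [/\ j != i0, sigma j = (W j).1 &
        ((W j).1 < (W i0).1)%N || nested (W i0) (W j)]].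
  rewrite /sigma; have [->|ji] := eqVneq j i0; first by constructor 1.
  have [sj|] := boolP (shifted j); first by constructor 2.
  rewrite /shifted /nested => nsj; constructor 3; split => //.
  have ne1 : (W j).1 != (W i0).1 :> nat.
    by apply: contraNneq ji => /val_inj/W1_inj ->.
  have ne2 : (W j).2 != (W i0).2 :> nat.
    by apply: contraNneq ji => /val_inj/W2_inj ->.
  move: nsj ne1 ne2; clear; lia.
have sigma_avoids j : sigma j != (W i0).1 :> nat.
  case: (sigmaP j) => [[_ ->]|[_ /andP[_ j2] ->]|[_ -> /orP[|/andP[]]]].
  - by rewrite gtn_eqF.
  - by rewrite gtn_eqF // (leq_ltn_trans (W_le i0)).
  - by move=> /ltn_eqF ->.
  - by move=> /gtn_eqF ->.
pose A1 : 'M[K]_(k, n) := \matrix_(i, x) ((x == (W i).1) || (x == sigma i))%:R.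
have diag i : A1 i (sigma i) != 0 by rewrite mxE eqxx orbT oner_neq0.
have below i j : j != i -> (n - (W i).1 <= n - (W j).1)%N -> A1 j (sigma i) = 0.
  move=> ji ij.
  have {ij} : ((W j).1 < (W i).1)%N.
    have : (W j).1 != (W i).1 :> nat by apply: contraNneq ji => /val_inj/W1_inj ->.
    have := ltn_ord (W i).1; have := ltn_ord (W j).1; move: ij; clear; lia.
  move=> ij; rewrite mxE; case: eqP => [E|_].
    move/(congr1 val): E => /=.
    case: (sigmaP i) => [[E ->]|[_ _ ->]|[_ -> _]].
    - by move: ic ij; rewrite E; clear; lia.
    - by have := W_le i; move: ij; clear; lia.
    - by move: ij; clear; lia.
  case: eqP => // E; exfalso; move: E ji ij.
  case: (sigmaP i) => [[-> ->]|[_ i2 ->]|[_ -> il]];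
    case: (sigmaP j) => [[-> ->]|[_ j2 ->]|[_ -> jl]].
  - by rewrite eqxx.
  - by move=> /(congr1 val) /=; move: j2 ci => /andP[_]; clear; lia.
  - by move=> /(congr1 val) /=; move: ic; clear; lia.
  - by move=> /(congr1 val) /=; move: i2 ci => /andP[_]; clear; lia.
  - by move=> /W2_inj ->; rewrite eqxx.
  - by move=> /(congr1 val) /=; have := W_le i; clear; lia.
  - case/orP: il => [il /(congr1 val) /=|/nes ne E].
      by move: il ic; clear; lia.
    by rewrite E eqxx in ne.
  - move=> /(congr1 val) /=; case/orP: il => [|/andP[_]]; case/andP: j2.
      by have := W_le j; clear; lia.
    by have := W_le i; clear; lia.
  - by move=> /W1_inj ->; rewrite eqxx.
have [m [s mE]] := minors_colsub (triangular_col_inj diag below).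
exists m; split => [A [Ap A0]|].
  rewrite mE; suff -> : \det (colsub sigma A) = 0 by rewrite mulr0.
  rewrite (expand_det_row _ i0) big1 // => j _; rewrite mxE A0 ?mul0r //.
    by rewrite -val_eqE; exact: sigma_avoids.
  case: (sigmaP j) => [[_ -> //]|[_ /andP[_ j2] ->]|[_ -> jl]].
    apply/negP => /(fintype.subsetP SF)/free_positionsP[_].
    by rewrite leqNgt j2.
  apply/negP => /(fintype.subsetP SF)/free_positionsP[j1 _ /(_ j)].
  case/orP: jl => [|-> /(_ isT)]; first by rewrite ltnNge (ltnW j1).
  by rewrite eqxx.
exists A1.
  split => [i|i x ix xS]; rewrite mxE ?eqxx // (negPf ix) /=.
  have [xE|//] := eqVneq; case/negP: xS; rewrite {x}xE in ix *.
  case: (sigmaP i) => [[-> ->] //|[_ /andP[i1 i2] E]|[_ E]]; last first.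
    by rewrite E eqxx in ix.
  rewrite E in ix *; apply: upS' => //; apply/free_positionsP; split => //.
    by rewrite ltn_neqAle W_le andbT eq_sym.
  move=> j /andP[_ ji]; apply: contraTneq (W_le j) => <-; rewrite -ltnNge.
  exact: ji.
rewrite mE mulf_neq0 ?signr_eq0 // -unitfE -unitmxE -row_free_unit.
apply: (@triangular_row_free _ _ _ _ (fun i => n - (W i).1)%N id).
  by move=> i; rewrite mxE.
by move=> i j ji ij; rewrite mxE; exact: below.
Qed.
End PatternedMatrices.

(** * Dimension of rank varieties *)

Section RankVarietyDimension.
Variables (K : fieldType) (V : vectType K) (n : nat) (e : n.-tuple V).
Hypothesis he : basis_of fullv e.
Hypothesis infK : forall p : {poly K}, p != 0 -> exists t, p.[t] != 0.
Variables (k : nat) (W : 'I_k -> 'I_n * 'I_n).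
Hypothesis W1_inj : forall i j, (W i).1 = (W j).1 -> i = j.
Hypothesis W2_inj : forall i j, (W i).2 = (W j).2 -> i = j.
Hypothesis W_le : forall i, ((W i).1 <= (W i).2)%N.
Local Notation pos := (('I_n * 'I_n) * 'I_n)%type.
Local Notation M := (finset (fun w : 'I_n * 'I_n => w \in codom W)).
Local Notation F := (free_positions M).

Definition interval_supported (A : 'M[K]_(k, n)) : Prop :=
  forall i (c : 'I_n), ~~ ((W i).1 <= c <= (W i).2)%N -> A i c = 0.

(** Row i of A is the combination of the rows of B indexed by i and by the
    intervals nested in W_i that has coordinate 1 at the left end of W_i and 0
    at the left ends of the nested ones. It exists because the entries of these
    rows at these left ends form a triangular matrix with nonzero diagonal. *)
Lemma interval_echelon (B : 'M[K]_(k, n)) :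
  interval_supported B -> (forall i, B i (W i).1 != 0) ->
  exists2 A, patterned W F A & mxspan e A = mxspan e B.
Proof.
move=> B0 B1.
pose inside i a := (a == i) || nested (W i) (W a).
(* T i is this triangular matrix, completed by the identity on the other indices. *)
pose T i : 'M[K]_k := \matrix_(a, b)
  if inside i a && inside i b then B a (W b).1 else (a == b)%:R.
have Tu i : T i \in unitmx.
  rewrite -row_free_unit.
  apply: (@triangular_row_free _ _ _ _ (fun a => (W a).1) id) => [a|a b ba ab].
    by rewrite mxE; case: ifP => _ //; rewrite eqxx oner_neq0.
  rewrite mxE; case: ifP => [_|_]; last by rewrite (negPf ba).
  apply: B0; rewrite negb_and -ltnNge ltn_neqAle ab andbT.
  by apply/orP; left; apply: contraNneq ba => /val_inj/W1_inj ->.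
have [x xT] : exists x : 'I_k -> 'rV[K]_k, forall i, x i *m T i = delta_mx 0 i.
  by exists (fun i => delta_mx 0 i *m invmx (T i)) => i; rewrite mulmxKV.
have x0 i a : ~~ inside i a -> x i 0 a = 0.
  move=> ia; move/rowP/(_ a): (xT i); rewrite mxE (bigD1 a) //= big1 => [|b ba].
    rewrite addr0 !mxE (negPf ia) eqxx mulr1 eqxx /= => ->.
    by rewrite (negPf (_ : a != i)) //; apply: contra ia => /eqP ->; rewrite /inside eqxx.
  by rewrite !mxE (negPf ia) andbF (negPf ba) mulr0.
pose A := (\matrix_i x i) *m B.
have AE i c : A i c = \sum_a x i 0 a * B a c.
  by rewrite mxE; apply: eq_bigr => a _; rewrite mxE.
have Ain i b : inside i b -> A i (W b).1 = (b == i)%:R.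
  move=> ib; rewrite AE; transitivity ((x i *m T i) 0 b); last first.
    by rewrite xT mxE eqxx.
  rewrite mxE; apply: eq_bigr => a _.
  have [ia|/x0 ->] := boolP (inside i a); last by rewrite !mul0r.
  by rewrite mxE ia ib.
have Ap : patterned W F A.
  split => [i|i c ic iF]; first by rewrite Ain ?eqxx // /inside eqxx.
  have [cW|cW] := boolP ((W i).1 <= c <= (W i).2)%N; last first.
    rewrite AE big1 // => a _; have [ia|/x0 ->] := boolP (inside i a); last first.
      by rewrite mul0r.
    rewrite B0 ?mulr0 //; move: cW; case/orP: ia => [/eqP -> //|/andP[]].
    by clear; lia.
  have [/existsP[b /andP[ib /eqP ->]]|nE] :=
    boolP [exists b, nested (W i) (W b) && (c == (W b).1)].
    rewrite Ain /inside ?ib ?orbT //.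
    case: eqP => // bi; move: ib; rewrite bi /nested ltnn //.
  case/negP: iF; apply/(free_positionsP W); move/andP: cW => [c1 c2]; split => //.
    by rewrite ltn_neqAle c1 andbT eq_sym.
  by move=> j ij; apply: contra nE => cj; apply/existsP; exists j; rewrite ij.
exists A => //; apply: eq_mxspan => //; apply/eqmxP.
have AB : (A <= B)%MS by apply: submxMl.
rewrite -(mxrank_leqif_eq AB) eqn_leq mxrankS //=.
apply: (leq_trans (rank_leq_row B)).
by rewrite row_leq_rank; apply: (patterned_row_free W1_inj) Ap.
Qed.

Lemma coord_basis_interval (w : 'I_n * 'I_n) v (c : 'I_n) :
  v \in basis_interval e w -> ~~ (w.1 <= c <= w.2)%N -> coord e c v = 0.
Proof.
move=> vw cw; rewrite (coord_span (X := in_tuple _) vw) linear_sum big1 // => i _.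
have /mapP[j + ->] := mem_nth 0 (ltn_ord i).
rewrite mem_enum inE linearZ /= (tnth_nth 0) (coord_free _ _ (basis_free he)) => jw.
by case: eqP cw jw => [<- /negPf ->|_ _ _] //; rewrite mulr0.
Qed.

Lemma vec_of_row_basis_interval (w : 'I_n * 'I_n) (u : 'rV[K]_n) :
  (forall c : 'I_n, ~~ (w.1 <= c <= w.2)%N -> u 0 c = 0) ->
  vec_of_row e u \in basis_interval e w.
Proof.
move=> u0; apply: memv_suml => c _.
have [cw|/u0 ->] := boolP (w.1 <= c <= w.2)%N; last by rewrite scale0r mem0v.
by rewrite -tnth_nth memvZ // mem_basis_interval // (basis_free he).
Qed.

Lemma span_enum_codom (b : 'I_n * 'I_n -> V) :
  <<[seq b w | w <- enum M]>>%VS = <<[tuple b (W i) | i < k]>>%VS.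
Proof.
apply: eq_span => v; apply/mapP/tnthP => [[w]|[i ->]].
  by rewrite mem_enum inE => /codomP[i ->] ->; exists i; rewrite tnth_mktuple.
by rewrite tnth_mktuple; exists (W i); rewrite // mem_enum inE codom_f.
Qed.

Lemma card_intervals : #|M| = k.
Proof.
rewrite cardsE card_codom ?card_ord // => i j Wij.
by apply: W1_inj; rewrite Wij.
Qed.

Lemma patterned_rank_locus (A : 'M[K]_(k, n)) : patterned W F A ->
  rank_locus e k M (mxspan e A).
Proof.
move=> Ap; have Af := patterned_row_free W1_inj (subxx _) Ap.
have GA := mxspan_grassmannian he Af; split => //.
pose b w := \sum_(i | W i == w) vec_of_row e (row i A).
have bE i : b (W i) = vec_of_row e (row i A).
  rewrite /b (big_pred1 i) // => j; apply/eqP/eqP => [Wij|-> //].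
  by apply: W1_inj; rewrite Wij.
exists b; split.
  rewrite basisEdim size_map -cardE card_intervals GA leqnn andbT span_enum_codom.
  rewrite /mxspan (_ : [tuple _ | i < k] = [tuple b (W i) | i < k]) ?subvv //.
  by apply: eq_from_tnth => i; rewrite !tnth_mktuple bE.
move=> w; rewrite inE => /codomP[i ->]; rewrite bE.
apply: vec_of_row_basis_interval => c cW; rewrite mxE.
case: Ap => _; apply.
  by apply: contraNneq cW => ->; rewrite leqnn W_le.
by apply: contra cW => /(free_positionsP W)[/ltnW -> ->].
Qed.

(** A basis adapted to the intervals may have zero coordinates at the left ends.
    Adding t at all of them gives, for almost all t, a matrix that
    [interval_echelon] applies to. *)
Lemma rank_locus_sub_spans :
  (rank_locus e k M `<=` zclosure e k (spans e (patterned W F)))%classic.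
Proof.
move=> U [GU [b [bU bM]]].
have bU' : basis_of U [tuple b (W i) | i < k].
  by rewrite basisEdim -span_enum_codom (span_basis bU) subvv size_tuple GU /=.
have [Af <-] := basis_coord_mx he bU'.
set A := coord_mx e _ in Af *.
have A0 : interval_supported A.
  move=> i c cW; rewrite mxE tnth_mktuple.
  by apply: coord_basis_interval cW; apply: bM; rewrite inE codom_f.
pose D : 'M[K]_(k, n) := \matrix_(i, c) (c == (W i).1)%:R.
pose g := \prod_i ('X + (A i (W i).1)%:P).
have Pf (B : 'M[K]_(k, n)) : patterned W F B -> row_free B.
  exact: (patterned_row_free W1_inj (subxx _)).
apply: (zclosure_perturb he infK (D := D) (g := g) Pf) => //.
  by apply: monic_neq0; apply: monic_prod => i _; exact: monicXaddC.
move=> t gt _; apply: sub_zclosure.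
have [||B Bp <-] := @interval_echelon (A + t *: D); last by exists B.
  move=> i c cW; rewrite !mxE tnth_mktuple.
  have := A0 i c cW; rewrite mxE tnth_mktuple => ->.
  rewrite (negPf (_ : c != (W i).1)) ?mulr0 ?addr0 //.
  by apply: contraNneq cW => ->; rewrite leqnn W_le.
move=> i; have := gt; rewrite horner_prod => /prodf_neq0/(_ i isT).
by rewrite hornerD hornerX hornerC !mxE eqxx mulr1 addrC.
Qed.

(** With the positions in order of decreasing left end, every free position of an
    interval that starts to the right of the one being extended is already
    switched on, as [separating_minor] requires. *)
Lemma has_chain_rank_variety : has_chain e k (rank_variety e k M) #|F|.
Proof.
pose le (p q : pos) := (q.1.1 <= p.1.1)%N.
have le_tr : transitive le by move=> y x z xy yz; exact: leq_trans yz xy.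
have le_tot : total le by move=> x y; exact: leq_total.
pose s := sort le (enum F).
have sz : size s = #|F| by rewrite size_sort -cardE.
have us : uniq s by rewrite sort_uniq enum_uniq.
have ms p : (p \in s) = (p \in F) by rewrite mem_sort mem_enum.
have ss : sorted le s by rewrite sort_sorted.
pose S t : {set pos} := finset (fun p => p \in take t s).
have SF t : S t \subset F.
  by apply/fintype.subsetP => p; rewrite inE => /mem_take; rewrite ms.
have Sle t u : (t <= u)%N -> S t \subset S u.
  move=> tu; apply/fintype.subsetP => p; rewrite !inE -(subnKC tu) takeD mem_cat.
  by move=> ->.
have Pf t (B : 'M[K]_(k, n)) : patterned W (S t) B -> row_free B.
  exact: (patterned_row_free W1_inj (SF t)).
exists (fun t => zclosure e k (spans e (patterned W (S t)))); split.
  move=> t _; have AG := spans_grassmannian he (Pf t); split.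
  - exact: zclosed_zclosure.
  - apply: (zirreducible_spans he infK (Pf t)); first exact: patterned_exists.
    by move=> A B u; exact: patterned_line.
  - have LG : (rank_locus e k M `<=` grassmannian k)%classic by move=> U [].
    apply: zclosure_min; first exact: zclosed_zclosure.
    move=> U [A /= Ap <-]; apply: sub_zclosure; apply: patterned_rank_locus.
    exact: patterned_sub (SF t) Ap.
move=> t tF; split.
  apply: zclosure_min; first exact/zclosed_zclosure/spans_grassmannian/Pf.
  move=> U [A /= Ap <-]; apply: sub_zclosure; exists A => //=.
  by apply: patterned_sub Ap; exact: Sle.
have /card_gt0P[p0 _] : (0 < #|F|)%N by apply: leq_ltn_trans tF.
pose p := nth p0 s t.
have ts : (t < size s)%N by rewrite sz.
have takeE : take t.+1 s = rcons (take t s) p by apply: take_nth.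
have pF : p \in F by rewrite -ms mem_nth.
have pS' : p \in S t.+1 by rewrite inE takeE mem_rcons mem_head.
have pS : p \notin S t.
  by have := take_uniq t.+1 us; rewrite takeE rcons_uniq inE => /andP[].
have upS (q : pos) : q \in F -> (p.1.1 < q.1.1)%N -> q \in S t.
  rewrite -ms => qs pq; rewrite inE; have [qt|tq] := ltnP (index q s) t.
    by rewrite -(nth_index p0 qs) -(nth_take p0 qt) mem_nth // size_takel // ltnW.
  suff : le p q by rewrite /le leqNgt pq.
  rewrite /p -[q in le _ q](nth_index p0 qs).
  by apply: (sorted_leq_nth le_tr _ _ ss); rewrite ?inE ?index_mem // => ?; apply: leqnn.
have [i0 p1] : exists i, p.1 = W i.
  by move: pF; rewrite !inE => /and3P[/codomP].
have pE : p = (W i0, p.2) by rewrite -p1 -surjective_pairing.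
have [|||m [mS [A Ap mA]]] := separating_minor K W1_inj W2_inj W_le (SF t) (SF t.+1)
    (i0 := i0) (c := p.2); rewrite -?pE //.
  move=> j x ij jF; apply: (fintype.subsetP (Sle _ _ (leqnSn t))).
  by apply: upS => //; rewrite p1.
move=> sub; have /sub/zclosureP : zclosure e k (spans e (patterned W (S t.+1))) (mxspan e A).
  by apply: sub_zclosure; exists A.
have hX : ('X_m : {mpoly K[nplucker n k]}) \is 1.-homog by rewrite dhomogX /= mdeg1.
move=> []; first exact/spans_grassmannian/Pf.
move=> _ /(_ 1%N 'X_m hX) X0.
have /X0/eqP : forall U, spans e (patterned W (S t)) U ->
    ('X_m : {mpoly K[nplucker n k]}).@[plucker e U] = 0.
  move=> _ [B /= Bp <-]; apply/eqP.
  by rewrite (homog_plucker_eq0 he (Pf _ _ Bp) hX) mevalXU mS.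
rewrite (homog_plucker_eq0 he (Pf _ _ Ap) hX) mevalXU.
by rewrite (negPf mA).
Qed.

Lemma zdim_codom : zdim e k (rank_variety e k M) = #|F|.
Proof.
have bound d : has_chain e k (rank_variety e k M) d -> (d <= #|F|)%N.
  have Pf (A : 'M[K]_(k, n)) : patterned W F A -> row_free A.
    exact: (patterned_row_free W1_inj (subxx _)).
  apply: (chain_length_bound he (Phi := pattern_mx K W F)).
    by move=> A /(patterned_specializations W1_inj)/Pf.
  have -> : specializations (pattern_mx K W F) = patterned W F.
    by apply/funext => A; apply/propext; split => /(patterned_specializations W1_inj).
  apply: zclosure_min; last exact: rank_locus_sub_spans.
  exact/zclosed_zclosure/spans_grassmannian.
apply: xget_unique => [|d [/bound dF dmax]].
  by split; [exact: has_chain_rank_variety | exact: bound].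
by apply/eqP; rewrite eqn_leq dF dmax //; exact: has_chain_rank_variety.
Qed.
End RankVarietyDimension.

(** * Counting rank sets *)

Lemma rank_setP n k (M : {set 'I_n * 'I_n}) : reflect
  [/\ #|M| = k, forall w, w \in M -> (w.1 <= w.2)%N,
      {in M &, injective fst} & {in M &, injective snd}]
  (rank_set k M).
Proof.
apply: (iffP and3P) => [[/eqP cM /forall_inP le /forall_inP inj]|[cM le inj1 inj2]].
  split => // w w' wM w'M ww'; apply/eqP; apply: contraT => nw;
    have /forall_inP/(_ w' w'M)/implyP/(_ nw)/andP[] := inj w wM;
    by rewrite ww' eqxx.
split; [exact/eqP|exact/forall_inP|].
apply/forall_inP => w wM; apply/forall_inP => w' w'M; apply/implyP => nw.
apply/andP; split; apply: contraNneq nw; first by move/(inj1 _ _ wM w'M) ->.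
by move/(inj2 _ _ wM w'M) ->.
Qed.

Lemma zdim_rank_variety (K : fieldType) (V : vectType K) (n : nat)
    (e : n.-tuple V) k (M : {set 'I_n * 'I_n}) :
  basis_of fullv e -> (forall p : {poly K}, p != 0 -> exists t, p.[t] != 0) ->
  rank_set k M -> zdim e k (rank_variety e k M) = #|free_positions M|.
Proof.
move=> he infK /rank_setP[cM le inj1 inj2].
pose W (i : 'I_k) : 'I_n * 'I_n := enum_val (cast_ord (esym cM) i).
have WM i : W i \in M by apply: enum_valP.
have WI : injective W by move=> i j /enum_val_inj/cast_ord_inj.
have ME : M = finset (fun w : 'I_n * 'I_n => w \in codom W).
  apply/setP => w; rewrite inE; apply/idP/codomP => [wM|[i ->] //].
  exists (cast_ord cM (enum_rank_in wM w)).
  by rewrite /W cast_ordK enum_rankK_in.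
rewrite ME; apply: zdim_codom => //.
- by move=> i j /(inj1 _ _ (WM i) (WM j))/WI.
- by move=> i j /(inj2 _ _ (WM i) (WM j))/WI.
- by move=> i; exact: le.
Qed.

(** The number of elements above l runs through 0, ..., #|C| - 1 as l runs through
    C in decreasing order. *)
Lemma sum_card_above N (C : {set 'I_N}) :
  \sum_(l in C) 'X^#|finset (fun c : 'I_N => (c \in C) && (l < c)%N)| = qint #|C|.
Proof.
move cC: #|C| => s; elim: s C cC => [|s IH] C cC.
  by rewrite /qint big_ord0 big_pred0 // => l; apply: (card0_eq cC).
have [c0 c0C] : exists c, c \in C by apply/card_gt0P; rewrite cC.
pose a := [arg min_(c < c0 in C) (c : nat)].
have [aC amin] : a \in C /\ forall c, c \in C -> (a <= c)%N.
  by rewrite /a; case: arg_minnP.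
have cCa : #|C :\ a| = s by move: cC; rewrite (cardsD1 a) aC => -[].
have above l : l \in C -> (l < a)%N = false by move=> lC; rewrite ltnNge amin.
rewrite (big_setD1 a) //= /qint big_ord_recr /= addrC; congr (_ + _).
  rewrite -[RHS](IH _ cCa); apply: eq_bigr => l; rewrite !inE => /andP[_ lC].
  congr ('X^ _); apply: eq_card => c; rewrite !inE.
  by have [->|] := eqVneq c a; rewrite ?above // andbF.
congr ('X^ _); rewrite -cCa; apply: eq_card => c; rewrite !inE andbC.
have [cC'|] := boolP (c \in C); last by rewrite !andbF.
by rewrite !andbT ltn_neqAle amin // andbT eq_sym.
Qed.

Lemma card_ord_lt N n : (n <= N)%N -> #|finset (fun c : 'I_N => (c < n)%N)| = n.
Proof.
move=> nN; rewrite -sum1_card; under eq_bigl => c do rewrite inE.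
by rewrite -(big_ord_widen N (fun=> 1%N) nN) sum1_card card_ord.
Qed.

Section Counting.
Variable N : nat.
Implicit Types (n k : nat) (M : {set 'I_N * 'I_N}).

Definition ends_before n M := [forall w in M, (w.2 < n)%N].

(** The ambient N stays fixed while n varies, so that rank sets for different n
    have the same type and can be compared without relabelling. *)
Definition truncated_rank_poly n k : {poly int} :=
  \sum_(M : {set 'I_N * 'I_N} | rank_set k M && ends_before n M)
    'X^#|free_positions M|.
Local Notation G := truncated_rank_poly.

Lemma truncated_rank_poly0 n : G n 0 = 1.
Proof.
rewrite /G (big_pred1 finset.set0) => [|M]; last first.
  apply/andP/eqP => [[/rank_setP[/cards0_eq]] //|->].
  split; last by apply/forall_inP => w; rewrite inE.
  by apply/rank_setP; split; rewrite ?cards0 // => w; rewrite inE.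
rewrite (_ : free_positions _ = finset.set0) ?cards0 ?expr0 //.
by apply/setP => p; rewrite !inE.
Qed.

Lemma truncated_rank_poly_gt n k : (n <= N)%N -> (n < k)%N -> G n k = 0.
Proof.
move=> nN nk; rewrite /G big_pred0 // => M; apply/negP => /andP[].
move=> /rank_setP[cM _ _ inj2] /forall_inP Mn; move: nk; rewrite ltnNge -cM.
rewrite -(card_in_imset inj2) -[X in (_ <= X)%N](card_ord_lt nN).
case/negP; apply: subset_leq_card; apply/fintype.subsetP => _ /imsetP[w wM ->].
by rewrite inE; exact: Mn.
Qed.

Section Step.
Variables (n k : nat) (nN : (n < N)%N).
Let last_end : 'I_N := Ordinal nN.

Definition left_ends M : {set 'I_N} := imset fst (mem M).

Definition add_interval (p : {set 'I_N * 'I_N} * 'I_N) : {set 'I_N * 'I_N} :=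
  (p.2, last_end) |: p.1.

Definition extendable k (p : {set 'I_N * 'I_N} * 'I_N) : bool :=
  [&& rank_set k p.1, ends_before n p.1, (p.2 <= n)%N & p.2 \notin left_ends p.1].

(** The default is never taken on the sets considered, which contain an interval
    with right end [last_end]. *)
Definition remove_interval M : {set 'I_N * 'I_N} * 'I_N :=
  let w := odflt (last_end, last_end) [pick w in M | w.2 == last_end] in
  (M :\ w, w.1).

Lemma left_endsP M c : reflect (exists2 w, w \in M & w.1 = c) (c \in left_ends M).
Proof. by apply: (iffP imsetP) => [[w wM ->]|[w wM <-]]; exists w. Qed.

Lemma ends_before_last M w : ends_before n M -> w \in M -> w.2 != last_end.
Proof. by move=> /forall_inP Mn /Mn; apply: contraTneq => ->; rewrite ltnn. Qed.

Lemma add_intervalK p : extendable k p -> remove_interval (add_interval p) = p.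
Proof.
case: p => M l /and4P[/= rM Mn ln lM]; rewrite /remove_interval /add_interval /=.
have nwM : (l, last_end) \notin M.
  by apply: contraL Mn => wM; apply/negP => /ends_before_last/(_ wM); rewrite eqxx.
case: pickP => [w /andP[]|/(_ (l, last_end))]; last by rewrite !inE !eqxx.
rewrite !inE => /orP[/eqP -> _|wM]; first by rewrite /= setU1K.
by rewrite (negPf (ends_before_last Mn wM)).
Qed.

Lemma rank_set_add_interval p : extendable k p ->
  [&& rank_set k.+1 (add_interval p), ends_before n.+1 (add_interval p)
    & [exists w in add_interval p, w.2 == last_end]].
Proof.
case: p => M l /and4P[/= /rank_setP[cM le inj1 inj2] Mn ln lM].
have nwM : (l, last_end) \notin M.
  by apply: contraL Mn => wM; apply/negP => /ends_before_last/(_ wM); rewrite eqxx.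
apply/and3P; split.
- apply/rank_setP; split.
  + by rewrite /add_interval cardsU1 nwM /= cM.
  + by move=> w; rewrite !inE => /orP[/eqP ->|/le].
  + move=> w w'; rewrite !inE /= => /orP[/eqP ->|wM] /orP[/eqP ->|w'M] //=.
    * by move=> lE; case/left_endsP: lM; exists w'.
    * by move=> lE; case/left_endsP: lM; exists w.
    * exact: inj1.
  + move=> w w'; rewrite !inE /= => /orP[/eqP ->|wM] /orP[/eqP ->|w'M] //=.
    * by move=> E; have := ends_before_last Mn w'M; rewrite -E eqxx.
    * by move=> E; have := ends_before_last Mn wM; rewrite E eqxx.
    * exact: inj2.
- apply/forall_inP => w; rewrite !inE => /orP[/eqP -> //|].
  by move/forall_inP: Mn => Mn /Mn/ltnW.
- by apply/exists_inP; exists (l, last_end); rewrite ?inE eqxx.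
Qed.

Lemma extendable_remove_interval M :
  rank_set k.+1 M -> ends_before n.+1 M -> [exists w in M, w.2 == last_end] ->
  extendable k (remove_interval M) /\ add_interval (remove_interval M) = M.
Proof.
move=> /rank_setP[cM le inj1 inj2] /forall_inP Mn /exists_inP[w0 w0M w0n].
rewrite /remove_interval; case: pickP => [[l r] /andP[/= wM /eqP wn]|/(_ w0)]; last first.
  by rewrite w0M w0n.
rewrite {r}wn in wM *; split; last by rewrite /add_interval /= finset.setD1K.
apply/and4P; split => /=.
- apply/rank_setP; split.
  + by move: cM; rewrite (cardsD1 (l, last_end)) wM => -[].
  + by move=> w; rewrite !inE => /andP[_ /le].
  + by move=> w w'; rewrite !inE => /andP[_ A] /andP[_ B]; exact: inj1.
  + by move=> w w'; rewrite !inE => /andP[_ A] /andP[_ B]; exact: inj2.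
- apply/forall_inP => w; rewrite !inE => /andP[ww wM']; rewrite ltn_neqAle.
  rewrite -ltnS Mn // andbT; apply: contraNneq ww => E; apply/eqP.
  by apply: inj2 => //; exact/val_inj.
- exact: le wM.
- apply/left_endsP => -[w]; rewrite !inE => /andP[ww wM'] E.
  by case/eqP: ww; exact: inj1.
Qed.

(** The new interval is nested in no other one, so that the free positions of the
    others are unchanged; all the others that start to its right are nested in
    it. *)
Lemma card_free_positions_add_interval p : extendable k p ->
  #|free_positions (add_interval p)| =
  (#|free_positions p.1| +
   #|finset (fun c : 'I_N => (c \in finset (fun c : 'I_N =>
      (c < n.+1)%N && (c \notin left_ends p.1))) && (p.2 < c)%N)|)%N.
Proof.
case: p => M l /and4P[/= /rank_setP[cM le inj1 inj2] Mn ln lM].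
have nwM : (l, last_end) \notin M.
  by apply: contraL Mn => wM; apply/negP => /ends_before_last/(_ wM); rewrite eqxx.
set C := finset (fun c : 'I_N => _ && (l < c)%N).
have E : free_positions (add_interval (M, l)) =
    free_positions M :|: imset (fun c => ((l, last_end), c)) (mem C).
  apply/setP => -[w c]; rewrite !inE /=; apply/idP/orP.
    move=> /and3P[wp /andP[wc cw] /forall_inP nes].
    case/orP: wp wc cw nes => [/eqP -> /= lc cn nes|wM wc cw nes].
      right; apply/imsetP; exists c => //; rewrite !inE lc ltnS cn andbT /=.
      apply/left_endsP => -[w' w'M cE].
      have : c != w'.1.
        apply: (implyP (nes w' _)); first by rewrite !inE w'M orbT.
        by rewrite /nested /= cE lc /=; exact: (forall_inP Mn).
      by rewrite cE eqxx.
    left; rewrite wM wc cw /=; apply/forall_inP => w' w'M.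
    by apply: nes; rewrite !inE w'M orbT.
  case=> [/and3P[wM wcw /forall_inP nes]|/imsetP[c' + [-> ->]]].
    rewrite wM orbT wcw /=; apply/forall_inP => w'; rewrite !inE.
    case/orP => [/eqP -> /=|]; last exact: nes.
    apply/implyP => /andP[_ /= nw2]; have := forall_inP Mn w wM.
    by rewrite ltnNge (ltnW nw2).
  rewrite !inE /= eqxx => /andP[/andP[cn cM'] ->] /=; rewrite -ltnS cn /=.
  apply/forall_inP => w'; rewrite !inE => /orP[/eqP ->|w'M]; apply/implyP.
    by rewrite /nested ltnn.
  by move=> _; apply: contraNneq cM' => ->; apply/left_endsP; exists w'.
rewrite E cardsU (_ : _ :&: _ = finset.set0) ?cards0 ?subn0; last first.
  apply/setP => -[w c]; rewrite !inE; apply/negP => /andP[/and3P[wM _ _]].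
  by move=> /imsetP[c' _ [wE _]]; move: nwM; rewrite -wE wM.
by rewrite card_imset // => c c' [].
Qed.

(** The first summand counts the sets without an interval ending at [last_end]; the
    others correspond, via [add_interval], to a smaller set and a left end. *)
Lemma truncated_rank_polyS : (k <= n)%N ->
  G n.+1 k.+1 = G n k.+1 + qint (n - k).+1 * G n k.
Proof.
move=> kn; rewrite /G (bigID (fun M => [exists w in M, w.2 == last_end])) /= addrC.
congr (_ + _).
  apply: eq_bigl => M; rewrite -andbA; congr (_ && _).
  apply/andP/forall_inP => [[/forall_inP Mn nE] w wM|Mn].
    rewrite ltn_neqAle -ltnS Mn // andbT; apply: contra nE => wn.
    by apply/exists_inP; exists w.
  split; first by apply/forall_inP => w /Mn/ltnW.
  apply/exists_inP => -[w wM wn]; have := Mn w wM.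
  by rewrite (eqP wn) ltnn.
rewrite (reindex_onto add_interval remove_interval) /= => [|M]; last first.
  by move=> /andP[/andP[rM Mn] wM]; case: (extendable_remove_interval rM Mn wM).
rewrite (eq_bigl (extendable k)) => [|p]; last first.
  apply/andP/idP => [[/andP[/andP[rM Mn] wM] /eqP E]|ep].
    by rewrite -E; case: (extendable_remove_interval rM Mn wM).
  by rewrite add_intervalK // -andbA rank_set_add_interval.
under eq_bigr => p ep do rewrite card_free_positions_add_interval // exprD.
pose C M := finset (fun c : 'I_N => (c < n.+1)%N && (c \notin left_ends M)).
transitivity (\sum_(M | rank_set k M && ends_before n M) \sum_(l in C M)
    ('X^#|free_positions M| *
     'X^#|finset (fun c : 'I_N => (c \in C M) && (l < c)%N)|) : {poly int}).
  rewrite pair_big_dep /=; apply: eq_bigl => -[M l].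
  by rewrite /extendable inE /= ltnS andbA.
rewrite mulr_sumr; apply: eq_bigr => M /andP[/rank_setP[cM le inj1 inj2] /forall_inP Mn].
rewrite -mulr_sumr sum_card_above mulrC; congr (qint _ * _).
have -> : C M = finset (fun c : 'I_N => (c < n.+1)%N) :\: left_ends M.
  by apply/setP => c; rewrite !inE andbC.
rewrite cardsD (finset.setIidPr _); last first.
  apply/fintype.subsetP => _ /left_endsP[w wM <-]; rewrite inE ltnW // ltnS.
  exact: leq_ltn_trans (le w wM) (Mn w wM).
by rewrite card_ord_lt // (card_in_imset inj1) cM subSn.
Qed.
End Step.

Lemma qstirling_gt m l : (m < l)%N -> qstirling m l = 0.
Proof.
elim: m l => [|m IH] [|l] //= ml.
by rewrite !IH ?mulr0 ?addr0 // ltnW.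
Qed.

Lemma qstirling_diag m : qstirling m m = 'X^'C(m, 2).
Proof.
elim: m => [|m IH] //=; rewrite IH (@qstirling_gt m m.+1) // mulr0 addr0 -exprD.
by rewrite binS bin1 addnC.
Qed.

Lemma truncated_rank_poly_qstirling n k : (n <= N)%N -> (k <= n)%N ->
  G n k * 'X^'C((n - k).+1, 2) = qstirling n.+1 (n - k).+1.
Proof.
elim: n k => [|n IH] [|k] // nN kn.
- by rewrite truncated_rank_poly0 mul1r subn0 qstirling_diag.
- by rewrite truncated_rank_poly0 mul1r subn0 qstirling_diag.
rewrite subSS -[RHS]/('X^(n - k) * qstirling n.+1 (n - k)
  + qint (n - k).+1 * qstirling n.+1 (n - k).+1).
rewrite truncated_rank_polyS // mulrDl -mulrA IH ?(ltnW nN) //; congr (_ + _).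
move: kn; rewrite ltnS leq_eqVlt => /orP[/eqP ->|kn].
  by rewrite subnn truncated_rank_poly_gt ?(ltnW nN) // mul0r mulr0.
rewrite -(subnSK kn) -IH ?(ltnW nN) // mulrCA -exprD addnC.
by rewrite binS bin1.
Qed.
End Counting.

(** * Comparison with the q-Stirling numbers *)

Lemma rank_poly_truncated (K : fieldType) (V : vectType K) (n : nat)
    (e : n.-tuple V) k :
  basis_of fullv e -> (forall p : {poly K}, p != 0 -> exists t, p.[t] != 0) ->
  rank_poly e k = truncated_rank_poly n n k.
Proof.
move=> he infK; apply: eq_big => [M|M rM]; last by rewrite zdim_rank_variety.
suff -> : ends_before n M by rewrite andbT.
by apply/forall_inP.
Qed.

Theorem corollary4p25 (R : realType) (n k : nat) (V : vectType R[i])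
    (e : n.-tuple V) (he : basis_of fullv e) (hk : (1 <= k <= n)%N) :
  tofrac (rank_poly e k) =
    tofrac (qstirling n.+1 (n - k + 1)) * tofrac 'X ^- 'C(n - k + 1, 2)
  :> {fraction {poly int}}.
Proof.
have [_ kn] := andP hk.
have infK (p : {poly R[i]}) : p != 0 -> exists t, p.[t] != 0.
  by move/closed_nonrootP.
rewrite rank_poly_truncated // addn1 -(@truncated_rank_poly_qstirling n) //.
by rewrite tofracM tofracXn mulfK // expf_neq0 // tofrac_eq0 polyX_eq0.
Qed.
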